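(* Let $m,n,p,q$ be positive integers, let $\mathbb{D}$ be an EAS division ring, and let $\phi : M_{m \times n}(\mathbb{D}) \to M_{p \times q}(\mathbb{D})$ be an adjacency preserver. Then either $\phi$ is degenerate or it is standard.
   Context: $M_{m\times n}(\mathbb{D})$ denotes the set of $m\times n$ matrices over the division ring $\mathbb{D}$, and $M_n(\mathbb{D})=M_{n\times n}(\mathbb{D})$. The rank of a matrix over $\mathbb{D}$ is the dimension of the left vector subspace of $\mathbb{D}^n$ spanned by its rows (equivalently, the dimension of the right vector space spanned by its columns). A division ring $\mathbb{D}$ is EAS if every (unital ring) endomorphism of $\mathbb{D}$ is surjective. Matrices $A,B$ of the same size are adjacent if $\mathrm{rank}(A-B)=1$. An adjacency preserver is a map $\phi$ such that $\phi(A)$ and $\phi(B)$ are adjacent whenever $A$ and $B$ are adjacent (one direction only; no injectivity or surjectivity is assumed). Standard: For a map $\tau:\mathbb{D}\to\mathbb{D}$, $A^\tau$ is the matrix obtained by applying $\tau$ to every entry of $A$; ${}^{t}A$ is the transpose. A map $\phi:M_{m\times n}(\mathbb{D})\to M_{p\times q}(\mathbb{D})$ is standard if one of the following holds: (1) $p\ge m$, $q\ge n$ and $\phi(A)=T\begin{bmatrix}A^\tau&0\\0&0\end{bmatrix}S+R$ for all $A$; or (2) $p\ge n$, $q\ge m$ and $\phi(A)=T\begin{bmatrix}{}^{t}(A^\sigma)&0\\0&0\end{bmatrix}S+R$ for all $A$; where $\tau$ is some automorphism of $\mathbb{D}$, $\sigma$ is some anti-automorphism of $\mathbb{D}$, $T\in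 M_p(\mathbb{D})$ and $S\in M_q(\mathbb{D})$ are some invertible matrices, and $R\in M_{p\times q}(\mathbb{D})$ is some matrix. Degenerate: For a nonzero row vector $y\in M_{1\times q}(\mathbb{D})$ put $R(y)=\{vy : v\in M_{p\times 1}(\mathbb{D})\}$, and for a nonzero column vector $x\in M_{p\times 1}(\mathbb{D})$ put $L(x)=\{xu : u\in M_{1\times q}(\mathbb{D})\}$; both are subsets of $M_{p\times q}(\mathbb{D})$. Let $M_{m\times n}^{\le 1}(\mathbb{D})$ be the set of $m\times n$ matrices of rank at most $1$. An adjacency preserver $\phi:M_{m\times n}(\mathbb{D})\to M_{p\times q}(\mathbb{D})$ is degenerate with respect to $A\in M_{m\times n}(\mathbb{D})$ if there are a nonzero $x\in M_{p\times 1}(\mathbb{D})$ and a nonzero $y\in M_{1\times q}(\mathbb{D})$ with $\phi(A+M_{m\times n}^{\le1}(\mathbb{D}))\subset(\phi(A)+R(y))\cup(\phi(A)+L(x))$. It is degenerate if it is degenerate with respect to every $A\in M_{m\times n}(\mathbb{D})$. *)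

(* Defs.v *)
From HB Require Import structures.
From mathcomp Require Import all_boot all_order all_algebra.

Set Implicit Arguments.
Unset Strict Implicit.
Unset Printing Implicit Defensive.

Import GRing.Theory.
Local Open Scope ring_scope.

(* The library's matrix rank and [unitmx] assume commutative scalars, so rank
   and invertibility are defined here.  [u *m A] is the left linear combination
   of the rows of [A] with coefficients [u]. *)

(* [GRing.field_axiom]: nonzero elements are units; [D] need not commute. *)
Definition division_ring (D : unitRingType) : Prop := GRing.field_axiom D.

Definition EAS (D : unitRingType) : Prop :=
  forall f : {rmorphism D -> D}, forall y : D, exists x : D, f x = y.

Definition in_row_space (D : nzRingType) (m n : nat) (A : 'M[D]_(m, n))
    (v : 'rV[D]_n) : Prop :=
  exists u : 'rV[D]_m, v = u *m A.

Definition left_independent (D : nzRingType) (r n : nat) (B : 'M[D]_(r, n)) :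
    Prop :=
  forall u : 'rV[D]_r, u *m B = 0 -> u = 0.

(* The left row space of [A] has a basis of [r] vectors, the rows of [B]. *)
Definition has_rank (D : nzRingType) (m n : nat) (A : 'M[D]_(m, n)) (r : nat) :
    Prop :=
  exists B : 'M[D]_(r, n),
    left_independent B /\
    (forall v : 'rV[D]_n, in_row_space B v <-> in_row_space A v).

Definition rank_le1 (D : nzRingType) (m n : nat) (A : 'M[D]_(m, n)) : Prop :=
  exists2 r : nat, (r <= 1)%N & has_rank A r.

Definition adjacent (D : nzRingType) (m n : nat) (A B : 'M[D]_(m, n)) : Prop :=
  has_rank (A - B) 1.

Definition adjacency_preserver (D : nzRingType) (m n p q : nat)
    (phi : 'M[D]_(m, n) -> 'M[D]_(p, q)) : Prop :=
  forall A B : 'M[D]_(m, n), adjacent A B -> adjacent (phi A) (phi B).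

Definition invertible_mx (D : nzRingType) (n : nat) (T : 'M[D]_n) : Prop :=
  exists T' : 'M[D]_n, T *m T' = 1%:M /\ T' *m T = 1%:M.

Definition pad_mx (D : nzRingType) (m n p q : nat) (le_mp : (m <= p)%N)
    (le_nq : (n <= q)%N) (A : 'M[D]_(m, n)) : 'M[D]_(p, q) :=
  castmx (subnKC le_mp, subnKC le_nq)
    (block_mx A 0 0 (0 : 'M[D]_(p - m, q - n))).

Definition standard_auto (D : nzRingType) (m n p q : nat)
    (phi : 'M[D]_(m, n) -> 'M[D]_(p, q)) : Prop :=
  exists (le_mp : (m <= p)%N) (le_nq : (n <= q)%N)
    (tau : {rmorphism D -> D}) (T : 'M[D]_p) (S : 'M[D]_q) (R : 'M[D]_(p, q)),
    [/\ bijective tau, invertible_mx T, invertible_mx S &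
        forall A : 'M[D]_(m, n),
          phi A = T *m pad_mx le_mp le_nq (map_mx tau A) *m S + R].

(* An anti-automorphism of [D] is a bijective ring morphism to the converse
   ring [D^c], which has the same carrier as [D]; the ascription of [sigma]
   makes all matrix products take place over [D]. *)
Definition standard_anti (D : nzRingType) (m n p q : nat)
    (phi : 'M[D]_(m, n) -> 'M[D]_(p, q)) : Prop :=
  exists (le_np : (n <= p)%N) (le_mq : (m <= q)%N)
    (sigma : {rmorphism D -> D^c}) (T : 'M[D]_p) (S : 'M[D]_q)
    (R : 'M[D]_(p, q)),
    [/\ bijective sigma, invertible_mx T, invertible_mx S &
        forall A : 'M[D]_(m, n),
          phi A =
            T *m pad_mx le_np le_mq (map_mx (sigma : D -> D) A)^T *m S + R].

Definition standard (D : nzRingType) (m n p q : nat)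
    (phi : 'M[D]_(m, n) -> 'M[D]_(p, q)) : Prop :=
  standard_auto phi \/ standard_anti phi.

Definition R_set (D : nzRingType) (p q : nat) (y : 'rV[D]_q)
    (X : 'M[D]_(p, q)) : Prop :=
  exists v : 'cV[D]_p, X = v *m y.

Definition L_set (D : nzRingType) (p q : nat) (x : 'cV[D]_p)
    (X : 'M[D]_(p, q)) : Prop :=
  exists u : 'rV[D]_q, X = x *m u.

(* [R_set y (phi (A + B) - phi A)] says that [phi (A + B)] lies in the
   translate [phi A + R(y)], and similarly for [L_set]. *)
Definition degenerate_at (D : nzRingType) (m n p q : nat)
    (phi : 'M[D]_(m, n) -> 'M[D]_(p, q)) (A : 'M[D]_(m, n)) : Prop :=
  exists (x : 'cV[D]_p) (y : 'rV[D]_q),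
    [/\ x != 0, y != 0 &
        forall B : 'M[D]_(m, n), rank_le1 B ->
          R_set y (phi (A + B) - phi A) \/ L_set x (phi (A + B) - phi A)].

Definition degenerate (D : nzRingType) (m n p q : nat)
    (phi : 'M[D]_(m, n) -> 'M[D]_(p, q)) : Prop :=
  forall A : 'M[D]_(m, n), degenerate_at phi A.

(* Main.v *)
(* Translate so that [phi 0 = 0], with [phi] not degenerate at [0]. A maximal
   clique through [0] is some L(x) = {x a} or R(y) = {a y}. If phi L(x1) lies
   in L(u) and phi L(x2) in R(v), then every phi R(y), a clique that contains
   phi (x1 y) and phi (x2 y), lies in L(u) or R(v), and [phi] is degenerate.
   So, after transposing the target (to matrices over the converse ring) if
   necessary, phi L(x) is in L(f x) and phi R(y) in R(g y), with [f] and [g]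
   projectively non-constant. Then x1 y1 + x2 y2 is sent to a matrix of rank
   two as soon as [f] separates x1, x2 and [g] separates y1, y2, and this
   forces the same picture at every base point: adjacency lines go to lines.

   On a 2 x 2 block put Phi Z = (phi Z^-1)^-1. When y Z x <> 0, the scalar
   g(y) (Phi Z) f(x) depends only on y Z x. This makes [Phi] act entrywise and
   gives a Pexider equation, so an entry of [Phi] is T + constant with [T]
   additive and a |-> T(1)^-1 T(a) a ring morphism. By EAS that morphism is
   onto; as the entry does not vanish at nonzero arguments, the constant is
   zero. (Over other division rings the constant may survive, and gives maps
   such as A |-> A (1 + C A)^-1.) Hence [phi] is additive on pairs of rank one
   matrices at every base point, so it is additive, and on rank one matrices
   it splits as phi (x y) = U(x) V(y) with [U], [V] semilinear. *)

Require Import Defs.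
From HB Require Import structures.
From mathcomp Require Import all_boot all_order all_algebra perm.
From Stdlib Require Import Classical IndefiniteDescription.

Set Implicit Arguments.
Unset Strict Implicit.
Unset Printing Implicit Defensive.

Import GRing.Theory.
Local Open Scope ring_scope.

(** * Linear algebra over a division ring *)

(** The source ring D and the target ring E are kept separate, so that the transposed case is the
    same argument with E the converse ring; EAS enters only as surjectivity of ring morphisms D ->
    E.

    Why inversion helps: adjacency says nothing linear by itself, but for invertible X = Z^-1 the
    rank one perturbation X - x d y is singular exactly when y Z x d = 1. Preserving singularity
    thus becomes preserving a scalar equation, and the scalar attached to the image can depend on Z
    only through y Z x.

    The maps [f] and [g] are known only up to a scalar at each point, so until surjectivity is
    available every statement about them is one about lines ([cpar], [rpar]). Their injectivity on
    lines is a late consequence of surjectivity on scalars; before that, separation of two chosen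
    points has to be carried along as a hypothesis. A two-element D, where a line through two points
    offers no scalar other than 0 and 1, is handled apart: E then has two elements too, and
    injectivity along cliques replaces the missing point. *)

Definition rk1 (D : nzRingType) p q (X : 'M[D]_(p, q)) : Prop :=
  exists (u : 'cV[D]_p) (v : 'rV[D]_q), X = u *m v.

(* Scalars are 1 x 1 matrices throughout, so that scaling columns on the right
   and rows on the left is ordinary matrix multiplication. *)
Definition cpar (D : nzRingType) p (u w : 'cV[D]_p) : Prop :=
  exists c : 'M[D]_1, w = u *m c.

Definition rpar (D : nzRingType) q (v w : 'rV[D]_q) : Prop :=
  exists c : 'M[D]_1, w = c *m v.

Section DivisionRingLinearAlgebra.
Variable D : unitRingType.
Hypothesis hD : division_ring D.

Lemma mx11_inv (c : 'M[D]_1) :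
  c != 0 -> exists d : 'M[D]_1, c *m d = 1%:M /\ d *m c = 1%:M.
Proof.
rewrite [c]mx11_scalar => c0; have /hD cU : c 0 0 != 0.
  by apply: contra c0 => /eqP ->; rewrite raddf0.
by exists ((c 0 0)^-1)%:M; rewrite -!scalar_mxM mulrV ?mulVr.
Qed.

Lemma mx_neq0_entry p q (X : 'M[D]_(p, q)) : X != 0 -> exists i j, X i j != 0.
Proof.
move=> X0; apply: NNPP => h; move/eqP: X0; apply; apply/matrixP=> i j.
by rewrite mxE; apply/eqP/negPn/negP => hij; apply: h; exists i, j.
Qed.

Lemma col_linv p (u : 'cV[D]_p) :
  u != 0 -> exists r : 'rV[D]_p, r *m u = 1%:M.
Proof.
move=> /mx_neq0_entry[i [j hij]]; exists ((u i j)^-1 *: delta_mx 0 i).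
rewrite -scalemxAl -rowE [row i u]mx11_scalar mxE.
move: hij; rewrite (ord1 j) => /hD uU.
by apply/matrixP=> a b; rewrite !mxE mulrnAr mulVr.
Qed.

Lemma row_rinv q (v : 'rV[D]_q) :
  v != 0 -> exists z : 'cV[D]_q, v *m z = 1%:M.
Proof.
move=> /mx_neq0_entry[i [j hij]]; exists (delta_mx j 0 *m ((v i j)^-1)%:M).
rewrite mulmxA -colE [col j v]mx11_scalar mxE -scalar_mxM.
by move: hij; rewrite (ord1 i) => /hD uU; rewrite mulrV.
Qed.

Lemma mx11_neq0 : (1%:M : 'M[D]_1) != 0.
Proof. by apply/eqP => /matrixP /(_ 0 0) /eqP; rewrite !mxE oner_eq0. Qed.

Lemma mulmx_cr_eq0 p q (u : 'cV[D]_p) (v : 'rV[D]_q) :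
  u *m v = 0 -> u = 0 \/ v = 0.
Proof.
case: (eqVneq u 0) => [->|/col_linv[r ru] uv]; [by left|right].
by rewrite -[v]mul1mx -ru -mulmxA uv mulmx0.
Qed.

Lemma mulmx_cr_neq0 p q (u : 'cV[D]_p) (v : 'rV[D]_q) :
  u != 0 -> v != 0 -> u *m v != 0.
Proof. by move=> /eqP u0 /eqP v0; apply/eqP => /mulmx_cr_eq0[]. Qed.

Lemma mulmx_c1_neq0 p (u : 'cV[D]_p) (c : 'M[D]_1) :
  u != 0 -> c != 0 -> u *m c != 0.
Proof. exact: mulmx_cr_neq0. Qed.

Lemma mulmx_1r_neq0 q (c : 'M[D]_1) (v : 'rV[D]_q) :
  c != 0 -> v != 0 -> c *m v != 0.
Proof. exact: mulmx_cr_neq0. Qed.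

Lemma cpar_trans p (u v w : 'cV[D]_p) : cpar u v -> cpar v w -> cpar u w.
Proof. by case=> a -> [b ->]; exists (a *m b); rewrite mulmxA. Qed.

Lemma rpar_trans q (u v w : 'rV[D]_q) : rpar u v -> rpar v w -> rpar u w.
Proof. by case=> a -> [b ->]; exists (b *m a); rewrite mulmxA. Qed.

(** [cpar u v] holds for [v = 0] whatever [u] is; a nonzero [v] makes the scalar invertible. *)
Lemma cpar_sym p (u v : 'cV[D]_p) : v != 0 -> cpar u v -> cpar v u.
Proof.
move=> v0 [c e]; have /mx11_inv[d [cd _]] : c != 0.
  by apply: contra v0 => /eqP c0; rewrite e c0 mulmx0.
by exists d; rewrite e -mulmxA cd mulmx1.
Qed.

Lemma rpar_sym q (u v : 'rV[D]_q) : v != 0 -> rpar u v -> rpar v u.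
Proof.
move=> v0 [c e]; have /mx11_inv[d [_ dc]] : c != 0.
  by apply: contra v0 => /eqP c0; rewrite e c0 mul0mx.
by exists d; rewrite e mulmxA dc mul1mx.
Qed.

Lemma cpar_eq p q (u u' : 'cV[D]_p) (v v' : 'rV[D]_q) :
  v != 0 -> u *m v = u' *m v' -> cpar u' u.
Proof.
move=> /row_rinv[z vz] e; exists (v' *m z).
by rewrite mulmxA -e -mulmxA vz mulmx1.
Qed.

Lemma rpar_eq p q (u u' : 'cV[D]_p) (v v' : 'rV[D]_q) :
  u != 0 -> u *m v = u' *m v' -> rpar v' v.
Proof.
move=> /col_linv[r ru] e; exists (r *m u').
by rewrite -mulmxA -e mulmxA ru mul1mx.
Qed.

(** Gram-Schmidt on functionals: [s] is normalised on the part of [b] outside the line of [u], then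
    corrected by [r] so as to vanish at [u]; in turn [r] is corrected by [r2]. *)
Lemma cpar_dual p (u b : 'cV[D]_p) : u != 0 -> ~ cpar u b ->
  exists r1 r2 : 'rV[D]_p,
    [/\ r1 *m u = 1%:M, r1 *m b = 0, r2 *m u = 0 & r2 *m b = 1%:M].
Proof.
move=> /col_linv[r ru] ub.
have /col_linv[s sb] : b - u *m (r *m b) != 0.
  by rewrite subr_eq0; apply/eqP => e; apply: ub; exists (r *m b).
set r2 := s - s *m u *m r.
have r2u : r2 *m u = 0 by rewrite mulmxBl -!mulmxA ru mulmx1 subrr.
have r2b : r2 *m b = 1%:M by rewrite -sb mulmxBl mulmxBr !mulmxA.
exists (r - r *m b *m r2), r2; split=> //.
  by rewrite mulmxBl -[_ *m r2 *m u]mulmxA r2u mulmx0 subr0.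
by rewrite mulmxBl -[_ *m r2 *m b]mulmxA r2b mulmx1 subrr.
Qed.

Lemma rpar_dual q (v a : 'rV[D]_q) : v != 0 -> ~ rpar v a ->
  exists z1 z2 : 'cV[D]_q,
    [/\ v *m z1 = 1%:M, a *m z1 = 0, v *m z2 = 0 & a *m z2 = 1%:M].
Proof.
move=> /row_rinv[z vz] va.
have /row_rinv[s sb] : a - a *m z *m v != 0.
  by rewrite subr_eq0; apply/eqP => e; apply: va; exists (a *m z).
set z2 := s - z *m (v *m s).
have z2v : v *m z2 = 0 by rewrite mulmxBr !mulmxA vz mul1mx subrr.
have z2a : a *m z2 = 1%:M by rewrite -sb mulmxBr mulmxBl !mulmxA.
exists (z - z2 *m (a *m z)), z2; split=> //.
  by rewrite mulmxBr (mulmxA v z2) z2v mul0mx subr0.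
by rewrite mulmxBr (mulmxA a z2) z2a mul1mx subrr.
Qed.

Lemma rk1_0 p q : rk1 (0 : 'M[D]_(p, q)).
Proof. by exists 0, 0; rewrite mul0mx. Qed.

Lemma rk1_mull r p q (A : 'M[D]_(r, p)) (X : 'M[D]_(p, q)) :
  rk1 X -> rk1 (A *m X).
Proof. by case=> u [v ->]; exists (A *m u), v; rewrite mulmxA. Qed.

Lemma rk1_mulr r p q (A : 'M[D]_(q, r)) (X : 'M[D]_(p, q)) :
  rk1 X -> rk1 (X *m A).
Proof. by case=> u [v ->]; exists u, (v *m A); rewrite mulmxA. Qed.

(** If [b] is not on the line of [u], functionals dual to [u] and [b] exhibit both [a] and [v] as
    multiples of the same row [w]. *)
Lemma rk1_add_par p q (u b : 'cV[D]_p) (a v : 'rV[D]_q) :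
  u != 0 -> v != 0 -> rk1 (u *m a + b *m v) -> cpar u b \/ rpar v a.
Proof.
move=> u0 v0 [c [w e]]; case: (classic (cpar u b)) => [|ub]; [by left|right].
have [r1 [r2 [r1u r1b r2u r2b]]] := cpar_dual u0 ub.
have ea : a = (r1 *m c) *m w.
  by rewrite -mulmxA -e mulmxDr !mulmxA r1u r1b mul0mx addr0 mul1mx.
have ev : v = (r2 *m c) *m w.
  by rewrite -mulmxA -e mulmxDr !mulmxA r2u r2b mul0mx add0r mul1mx.
have wv : rpar w v by exists (r2 *m c).
by apply: rpar_trans (rpar_sym v0 wv) _; exists (r1 *m c).
Qed.

Lemma rk1_sub_par p q (u b : 'cV[D]_p) (a v : 'rV[D]_q) :
  u != 0 -> v != 0 -> rk1 (u *m a - b *m v) -> cpar u b \/ rpar v a.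
Proof.
move=> u0 v0; rewrite -mulNmx => /(rk1_add_par u0 v0)[[c e]|]; last by right.
by left; exists (- c); rewrite mulmxN -e opprK.
Qed.

(** Fix a nonzero member [u v]. A member outside L(u) must share the row line of [v], a member
    outside R(v) the column line of [u]; two such members would differ by rank two, so only one kind
    occurs. *)
Lemma rk1_clique p q (S : 'M[D]_(p, q) -> Prop) :
  (forall X, S X -> rk1 X) -> (forall X Y, S X -> S Y -> rk1 (X - Y)) ->
  (exists2 X, S X & X != 0) ->
  (exists2 u : 'cV_p, u != 0 & forall X, S X -> exists b, X = u *m b) \/
  (exists2 v : 'rV_q, v != 0 & forall X, S X -> exists b, X = b *m v).
Proof.
move=> S1 SS [X0 SX0 X00]; have [u [v e0]] := S1 _ SX0.
have u0 : u != 0 by apply: contra X00 => /eqP h; rewrite e0 h mul0mx.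
have v0 : v != 0 by apply: contra X00 => /eqP h; rewrite e0 h mulmx0.
case: (classic (exists2 X, S X & ~ exists b, X = u *m b)); last first.
  move=> h; left; exists u => // X SX; apply: NNPP => hX.
  by apply: h; exists X.
case=> X1 SX1 n1; right; exists v => // X2 SX2; apply: NNPP => n2.
have [u1 [v1 e1]] := S1 _ SX1; have [u2 [v2 e2]] := S1 _ SX2.
have v10 : v1 != 0.
  by apply/eqP => h; apply: n1; exists 0; rewrite e1 h !mulmx0.
have u20 : u2 != 0.
  by apply/eqP => h; apply: n2; exists 0; rewrite e2 h !mul0mx.
have uu1 : ~ cpar u u1.
  by case=> c h; apply: n1; exists (c *m v1); rewrite mulmxA -h.
have vv2 : ~ rpar v v2.
  by case=> c h; apply: n2; exists (u2 *m c); rewrite -mulmxA -h.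
have : rk1 (X0 - X1) by apply: SS.
rewrite e0 e1 => /(rk1_sub_par u0 v10)[//|v1v].
have vv1 : rpar v v1 by apply: rpar_sym v1v.
have : rk1 (X2 - X0) by apply: SS.
rewrite e0 e2 => /(rk1_sub_par u20 v0)[u2u|//].
have : rk1 (X2 - X1) by apply: SS.
rewrite e1 e2 => /(rk1_sub_par u20 v10)[u2u1|/(rpar_trans vv1)//].
by apply: uu1; apply: cpar_trans u2u1; apply: cpar_sym u2u.
Qed.

Lemma invertible_mx1 n : invertible_mx (1%:M : 'M[D]_n).
Proof. by exists 1%:M; rewrite mulmx1. Qed.

Lemma invertible_mxM n (A B : 'M[D]_n) :
  invertible_mx A -> invertible_mx B -> invertible_mx (A *m B).
Proof.
move=> [A' [h1 h2]] [B' [h3 h4]]; exists (B' *m A'); split.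
  by rewrite mulmxA -(mulmxA A) h3 mulmx1.
by rewrite mulmxA -(mulmxA B') h2 mulmx1.
Qed.

(** Column operations: a permutation brings a nonzero entry to the front, then [S] scales it to 1
    and clears the rest. *)
Lemma row_complete n (b : 'rV[D]_(1 + n)) : b != 0 ->
  exists2 S : 'M[D]_(1 + n), invertible_mx S & b *m S = row_mx 1%:M 0.
Proof.
move=> /mx_neq0_entry[i0 [i hi]]; rewrite (ord1 i0) {i0} in hi.
pose P : 'M[D]_(1 + n) := tperm_mx (lshift n 0) i.
have Pinv : invertible_mx P.
  by exists P; rewrite -perm_mxM tperm2 perm_mx1.
have bP : (b *m P) 0 (lshift n 0) = b 0 i by rewrite -xcolE mxE tpermL.
pose c := lsubmx (b *m P); pose b' := rsubmx (b *m P).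
have /mx11_inv[d [cd dc]] : c != 0.
  by apply: contra hi => /eqP/matrixP/(_ 0 0); rewrite !mxE -/P -bP mxE => ->.
pose S : 'M_(1 + n) := block_mx d (- (d *m b')) 0 1%:M.
have Sinv : invertible_mx S.
  exists (block_mx c b' 0 1%:M).
  split; rewrite mulmx_block !mul0mx !mulmx0 !mulmx1 ?mul1mx !addr0 !add0r.
    by rewrite dc subrr -scalar_mx_block.
  by rewrite cd mulmxN mulmxA cd mul1mx addNr -scalar_mx_block.
exists (P *m S); first exact: invertible_mxM.
rewrite mulmxA -[b *m P]hsubmxK -/c -/b' /S mul_row_block mulmx0 addr0 cd.
by rewrite mulmx1 mulmxN mulmxA cd mul1mx addNr.
Qed.

Lemma pid_mx_tr r n : (r <= n)%N ->
  (pid_mx r : 'M[D]_(r, n)) *m (pid_mx r : 'M[D]_(n, r)) = 1%:M.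
Proof. by move=> rn; rewrite pid_mx_id // pid_mx_1. Qed.

Lemma invertible_block_lower n (S : 'M[D]_n) (Y : 'cV[D]_n) :
  invertible_mx S -> invertible_mx (block_mx 1%:M 0 Y S : 'M_(1 + n)).
Proof.
move=> [T [ST TS]]; exists (block_mx 1%:M 0 (- (T *m Y)) T).
split; rewrite mulmx_block !mul0mx !mulmx0 !mulmx1 ?mul1mx !addr0 !add0r.
  by rewrite mulmxN mulmxA ST mul1mx subrr -scalar_mx_block.
by rewrite TS addNr -scalar_mx_block.
Qed.

(** Induction on the rows: once [row_complete] has normalised the first one, the lower right block
    is still independent and is completed by induction. *)
Lemma left_independent_complete r n (B : 'M[D]_(r, n)) :
  left_independent B ->
  (r <= n)%N /\ exists2 S : 'M[D]_n, invertible_mx S & B = pid_mx r *m S.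
Proof.
move=> hB; suff [rn [S [T [ST TS]] BS]] :
    (r <= n)%N /\ exists2 S : 'M[D]_n, invertible_mx S & B *m S = pid_mx r.
  by split=> //; exists T; [exists S | rewrite -BS -mulmxA ST mulmx1].
elim: r n B hB => [|r IHr] n B hB.
  by split=> //; exists 1%:M; [exact: invertible_mx1 | apply/matrixP=> -[]].
have B0 : row 0 B != 0.
  apply/eqP; rewrite rowE => /hB /matrixP/(_ 0 0)/eqP.
  by rewrite !mxE !eqxx oner_eq0.
case: n B hB B0 => [|n] B hB B0; first by case/eqP: B0; apply/matrixP=> ? [].
have [S Sinv BS] := @row_complete n _ B0.
pose B' : 'M_(1 + r, 1 + n) := (B : 'M_(1 + r, 1 + n)) *m S.
have e1 : usubmx B' = row_mx 1%:M 0.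
  rewrite -BS -row_mul; apply/matrixP=> i j; rewrite !mxE.
  by apply: eq_bigr => k _; congr (B _ _ * _); apply/val_inj; rewrite /= ord1.
pose c := dlsubmx B'; pose B'' := drsubmx B'.
have eB' : B' = block_mx 1%:M 0 c B''.
  by rewrite -[LHS]vsubmxK e1 /block_mx -[dsubmx B']hsubmxK.
have hB'' : left_independent B''.
  move=> u uB; pose w : 'rV_(1 + r) := row_mx (- (u *m c)) u.
  have : w *m B' = 0.
    by rewrite eB' mul_row_block mulmx1 mulmx0 uB addNr addr0 row_mx0.
  have [T [ST _]] := Sinv.
  move=> /(congr1 (mulmx^~ T)); rewrite /B' mul0mx -!mulmxA ST mulmx1 => /hB.
  by move=> h; have := congr1 (@rsubmx D 1 1 r) h; rewrite row_mxKr linear0.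
have [rn [S1 S1inv BS1]] := IHr _ _ hB''.
(* [X] is chosen to clear [c], the column below the first pivot. *)
split=> //; pose X : 'M_(n, 1) := - (pid_mx r *m c).
exists (S *m block_mx 1%:M 0 (S1 *m X) S1).
  by apply: invertible_mxM => //; apply: invertible_block_lower.
rewrite mulmxA -/B' [X in X *m _]eB'.
etransitivity; first exact: (@mulmx_block D 1 r 1 n 1 n).
rewrite !mul0mx !mulmx0 !mulmx1 !addr0 add0r mulmxA BS1.
rewrite /X mulmxN mulmxA pid_mx_tr // mul1mx subrr.
apply/matrixP=> i j.
rewrite !mxE; case: splitP => i' ei; rewrite !mxE; case: splitP => j' ej;
  rewrite !mxE ei ej ?(ord1 i') ?(ord1 j') //=.
Qed.

(** A relation [u] between the rows can be moved to the first coordinate vector by a change of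
    basis; the first row of [T *m X] then vanishes and a single row is left. *)
Lemma invertible_or_rk1 (X : 'M[D]_2) : invertible_mx X \/ rk1 X.
Proof.
case: (classic (left_independent X)) => [|/not_all_ex_not[u hu]].
  case/left_independent_complete=> _ [S hS ->].
  by rewrite pid_mx_1 mul1mx; left.
have [uX /eqP u0] := imply_to_and _ _ hu; right.
have [S [T [ST TS]] uS] := @row_complete 1 u u0.
pose Y : 'M_(1 + 1, 2) := T *m X.
have uY : usubmx Y = 0.
  rewrite -[LHS]mul1mx -[LHS]addr0 -[X in _ + X](mul0mx _ (dsubmx Y)).
  by rewrite -mul_row_col vsubmxK -uS /Y -mulmxA (mulmxA S) ST mul1mx.
exists (S *m col_mx 0 1%:M), (dsubmx Y).
rewrite -mulmxA mul_col_mx mul0mx mul1mx -{1}uY vsubmxK mulmxA.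
by rewrite ST mul1mx.
Qed.

Lemma has_rank1P p q (X : 'M[D]_(p, q)) : has_rank X 1 <-> X != 0 /\ rk1 X.
Proof.
split=> [[B [Bfree BX]]|[X0 [u [v e]]]].
  have Xrow i : exists c : 'M_1, row i X = c *m B.
    by apply/BX; exists (delta_mx 0 i); rewrite rowE.
  have [c hc] := functional_choice _ Xrow.
  split; last first.
    exists (\col_i c i 0 0), B; apply/row_matrixP=> i.
    rewrite hc row_mul; congr (_ *m B); apply/matrixP=> a b.
    by rewrite !ord1 !mxE.
  apply/eqP=> X0; have [|u eB] := (BX B).1.
    by exists 1%:M; rewrite mul1mx.
  suff: (1%:M : 'M[D]_1) = 0 by apply/eqP/mx11_neq0.
  by apply: Bfree; rewrite mul1mx eB X0 mulmx0.
have u0 : u != 0 by apply: contra X0 => /eqP h; rewrite e h mul0mx.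
have v0 : v != 0 by apply: contra X0 => /eqP h; rewrite e h mulmx0.
exists v; split=> [a /mulmx_cr_eq0[//|/eqP]|w]; first by rewrite (negPf v0).
have [r ru] := col_linv u0; split=> -[a ->].
  by exists (a *m r); rewrite e -mulmxA (mulmxA r) ru mul1mx.
by exists (a *m u); rewrite e mulmxA.
Qed.

Lemma rk1_rank_le1 p q (X : 'M[D]_(p, q)) : rank_le1 X -> rk1 X.
Proof.
case=> [[|[|r]]] // _; last by case/has_rank1P.
case=> B [_ BX]; suff -> : X = 0 by apply: rk1_0.
apply/row_matrixP=> i; have [|a ->] := (BX (row i X)).2.
  by exists (delta_mx 0 i); rewrite rowE.
by rewrite row0; apply/matrixP=> k l; rewrite !mxE big_ord0.
Qed.

End DivisionRingLinearAlgebra.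

(** * Images of the maximal cliques *)

(** [rk1] includes the zero matrix, so adjacency reads as distinctness together with a [rk1]
    difference. *)
Definition rk1_preserver (D E : nzRingType) m n p q
    (phi : 'M[D]_(m, n) -> 'M[E]_(p, q)) : Prop :=
  forall A B, A != B -> rk1 (A - B) -> phi A != phi B /\ rk1 (phi A - phi B).

Definition recenter (D E : nzRingType) m n p q
    (phi : 'M[D]_(m, n) -> 'M[E]_(p, q)) (A X : 'M[D]_(m, n)) :=
  phi (A + X) - phi A.

Definition degenerate_rk1 (D E : nzRingType) m n p q
    (phi : 'M[D]_(m, n) -> 'M[E]_(p, q)) : Prop :=
  exists (u : 'cV_p) (v : 'rV_q), [/\ u != 0, v != 0 &
    forall (x : 'cV_m) (y : 'rV_n), (exists b, phi (x *m y) = u *m b) \/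
                (exists b, phi (x *m y) = b *m v)].

(* By [al_f] and [al_g], neither [f] nor [g] is constant as a map of projective
   spaces; given the other fields, this amounts to nondegeneracy at [0]. *)
Record aligned (D E : nzRingType) m n p q
    (phi : 'M[D]_(m, n) -> 'M[E]_(p, q))
    (f : 'cV[D]_m -> 'cV[E]_p) (g : 'rV[D]_n -> 'rV[E]_q) : Prop := Aligned {
  al_f0 : forall x, x != 0 -> f x != 0;
  al_g0 : forall y, y != 0 -> g y != 0;
  al_L : forall x, x != 0 -> forall a, exists b, phi (x *m a) = f x *m b;
  al_R : forall y, y != 0 -> forall a, exists b, phi (a *m y) = b *m g y;
  al_f : forall u, u != 0 -> exists2 x, x != 0 & ~ cpar u (f x);
  al_g : forall v, v != 0 -> exists2 y, y != 0 & ~ rpar v (g y) }.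

Definition is_aligned (D E : nzRingType) m n p q
    (phi : 'M[D]_(m, n) -> 'M[E]_(p, q)) : Prop :=
  exists f g, aligned phi f g.

Section CliqueTypes.
Variables D E : unitRingType.
Hypotheses (hD : division_ring D) (hE : division_ring E).
Variables m n p q : nat.
Hypotheses (hm : (0 < m)%N) (hn : (0 < n)%N).
Implicit Types (phi : 'M[D]_(m, n) -> 'M[E]_(p, q)).
Implicit Types (x : 'cV[D]_m) (y : 'rV[D]_n) (u : 'cV[E]_p) (v : 'rV[E]_q).

Lemma ex_cV_neq0 : exists x : 'cV[D]_m, x != 0.
Proof.
exists (const_mx 1); apply/eqP => /matrixP /(_ (Ordinal hm) 0) /eqP.
by rewrite !mxE oner_eq0.
Qed.

Lemma ex_rV_neq0 : exists y : 'rV[D]_n, y != 0.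
Proof.
exists (const_mx 1); apply/eqP => /matrixP /(_ 0 (Ordinal hn)) /eqP.
by rewrite !mxE oner_eq0.
Qed.

Lemma recenter_preserver phi A :
  rk1_preserver phi -> rk1_preserver (recenter phi A).
Proof.
move=> h X Y XY XY1; rewrite /recenter opprB addrA subrK.
have [||h1 h2] := h (A + X) (A + Y); first by rewrite (inj_eq (addrI A)).
  by rewrite opprD addrACA subrr add0r.
by split=> //; rewrite (inj_eq (addIr _)).
Qed.

Lemma recenter0 phi A : recenter phi A 0 = 0.
Proof. by rewrite /recenter addr0 subrr. Qed.

Lemma preserver_rk1 phi A B :
  rk1_preserver phi -> rk1 (A - B) -> rk1 (phi A - phi B).
Proof.
move=> h; case: (eqVneq A B) => [-> _|AB /(h _ _ AB)[]//].
by rewrite subrr; apply: rk1_0.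
Qed.

Section AtZero.
Variable phi : 'M[D]_(m, n) -> 'M[E]_(p, q).
Hypotheses (hphi : rk1_preserver phi) (phi0 : phi 0 = 0).

Lemma preserver0_rk1 x y : rk1 (phi (x *m y)).
Proof.
rewrite -[phi _]subr0 -phi0; apply: preserver_rk1 => //.
by rewrite subr0; exists x, y.
Qed.

Lemma preserver0_neq0 x y : x != 0 -> y != 0 -> phi (x *m y) != 0.
Proof.
move=> x0 y0; rewrite -phi0; apply: (hphi _ _).1.
  exact: mulmx_cr_neq0.
by rewrite subr0; exists x, y.
Qed.

Lemma clique_L x : x != 0 ->
  (exists2 u : 'cV_p, u != 0 & forall a, exists b, phi (x *m a) = u *m b) \/
  (exists2 v : 'rV_q, v != 0 & forall a, exists b, phi (x *m a) = b *m v).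
Proof.
move=> x0; have [y y0] := ex_rV_neq0.
have [|||[u u0 hu]|[v v0 hv]] :=
  @rk1_clique E hE p q (fun X => exists a, X = phi (x *m a)).
- by move=> _ [a ->]; apply: preserver0_rk1.
- move=> _ _ [a ->] [b ->]; apply: preserver_rk1 => //.
  by rewrite -mulmxBr; exists x, (a - b).
- by exists (phi (x *m y)); [exists y | apply: preserver0_neq0].
- by left; exists u => // a; apply: hu; exists a.
- by right; exists v => // a; apply: hv; exists a.
Qed.

Lemma clique_R y : y != 0 ->
  (exists2 u : 'cV_p, u != 0 & forall a, exists b, phi (a *m y) = u *m b) \/
  (exists2 v : 'rV_q, v != 0 & forall a, exists b, phi (a *m y) = b *m v).
Proof.
move=> y0; have [x x0] := ex_cV_neq0.
have [|||[u u0 hu]|[v v0 hv]] :=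
  @rk1_clique E hE p q (fun X => exists a, X = phi (a *m y)).
- by move=> _ [a ->]; apply: preserver0_rk1.
- move=> _ _ [a ->] [b ->]; apply: preserver_rk1 => //.
  by rewrite -mulmxBl; exists (a - b), y.
- by exists (phi (x *m y)); [exists x | apply: preserver0_neq0].
- by left; exists u => // a; apply: hu; exists a.
- by right; exists v => // a; apply: hv; exists a.
Qed.

Lemma mixed_types_degenerate x1 x2 u v :
  x1 != 0 -> x2 != 0 -> u != 0 -> v != 0 ->
  (forall a, exists b, phi (x1 *m a) = u *m b) ->
  (forall a, exists b, phi (x2 *m a) = b *m v) -> degenerate_rk1 phi.
Proof.
move=> x10 x20 u0 v0 h1 h2; exists u, v; split=> // x y.
case: (eqVneq y 0) => [->|y0].
  by left; exists 0; rewrite !mulmx0.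
have [a e1] := h1 y; have [b e2] := h2 y.
have n1 := preserver0_neq0 x10 y0; have n2 := preserver0_neq0 x20 y0.
have b0 : b != 0 by apply: contra n2 => /eqP h; rewrite e2 h mul0mx.
have a0 : a != 0 by apply: contra n1 => /eqP h; rewrite e1 h mulmx0.
case: (clique_R y0) => -[w w0 hw].
- left; have [c ec] := hw x1.
  have [d ed] : cpar u w.
    apply: cpar_sym => //; apply: (cpar_eq hE (v := a) (v' := c)) => //.
    by rewrite -ec -e1.
  by have [b' ->] := hw x; exists (d *m b'); rewrite ed mulmxA.
- right; have [c ec] := hw x2.
  have [d ed] : rpar v w.
    apply: rpar_sym => //; apply: (rpar_eq hE (u := b) (u' := c)) => //.
    by rewrite -ec -e2.
  by have [b' ->] := hw x; exists (b' *m d); rewrite ed mulmxA.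
Qed.

Lemma aligned_of_types :
  (forall x, x != 0 ->
    exists2 u : 'cV_p, u != 0 & forall a, exists b, phi (x *m a) = u *m b) ->
  (forall y, y != 0 ->
    exists2 v : 'rV_q, v != 0 & forall a, exists b, phi (a *m y) = b *m v) ->
  ~ degenerate_rk1 phi -> is_aligned phi.
Proof.
move=> hL hR ndeg.
(* The zero vector spans no line; it gets the value 0 so that choice yields total functions. *)
have hL' x : exists u : 'cV_p, x != 0 ->
    u != 0 /\ forall a, exists b, phi (x *m a) = u *m b.
  case: (eqVneq x 0) => [_|/hL[u u0 hu]]; first by exists 0.
  by exists u.
have hR' y : exists v : 'rV_q, y != 0 ->
    v != 0 /\ forall a, exists b, phi (a *m y) = b *m v.
  case: (eqVneq y 0) => [_|/hR[v v0 hv]]; first by exists 0.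
  by exists v.
have [f hf] := functional_choice _ hL'; have [g hg] := functional_choice _ hR'.
have [x1 x10] := ex_cV_neq0; have [y1 y10] := ex_rV_neq0.
exists f, g; split=> [x /hf[]//|y /hg[]//|x /hf[]//|y /hg[]//|u u0|v v0].
(* If every [f x] were parallel to [u], all rank one matrices would go into L(u), and [phi] would be
   degenerate. *)
- apply: NNPP => hn'; apply: ndeg; exists u, (g y1); split=> //.
    by case: (hg _ y10).
  move=> x y; left; case: (eqVneq x 0) => [->|x0].
    by exists 0; rewrite mul0mx mulmx0.
  have [c ec] : cpar u (f x).
    by apply: NNPP => hc; apply: hn'; exists x.
  by have [_ /(_ y)[b ->]] := hf _ x0; exists (c *m b); rewrite ec mulmxA.
- apply: NNPP => hn'; apply: ndeg; exists (f x1), v; split=> //.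
    by case: (hf _ x10).
  move=> x y; right; case: (eqVneq y 0) => [->|y0].
    by exists 0; rewrite mulmx0 mul0mx.
  have [c ec] : rpar v (g y).
    by apply: NNPP => hc; apply: hn'; exists y.
  by have [_ /(_ x)[b ->]] := hg _ y0; exists (b *m c); rewrite ec mulmxA.
Qed.

Lemma clique_types :
  [\/ degenerate_rk1 phi, is_aligned phi |
      (forall x, x != 0 -> exists2 v : 'rV_q, v != 0 &
         forall a, exists b, phi (x *m a) = b *m v) /\
      (forall y, y != 0 -> exists2 u : 'cV_p, u != 0 &
         forall a, exists b, phi (a *m y) = u *m b)].
Proof.
case: (classic (degenerate_rk1 phi)) => [|ndeg]; first by constructor 1.
have [x1 x10] := ex_cV_neq0; have [y1 y10] := ex_rV_neq0.
have [[x x0 [u u0 hu]]|nL] := classic (exists2 x : 'cV_m, x != 0 &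
  exists2 u : 'cV_p, u != 0 & forall a, exists b, phi (x *m a) = u *m b).
  have hL x' : x' != 0 -> exists2 u : 'cV_p, u != 0 &
      forall a, exists b, phi (x' *m a) = u *m b.
    move=> x'0; case: (clique_L x'0) => [//|[v v0 hv]].
    by case: ndeg; apply: (mixed_types_degenerate x0 x'0 u0 v0).
  constructor 2; apply: aligned_of_types => // y y0.
  case: (clique_R y0) => // -[w w0 hw]; case: ndeg.
  (* Each phi L(x') lies in some L(u') and meets L(w) in the nonzero matrix phi (x' y), so
     everything collapses into L(w). *)
  have hall x' y' : exists b, phi (x' *m y') = w *m b.
    case: (eqVneq x' 0) => [->|x'0].
      by exists 0; rewrite mul0mx mulmx0.
    have [u' u'0 hu'] := hL _ x'0; have [b1 e1] := hu' y; have [b2 e2] := hw x'.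
    have b10 : b1 != 0.
      apply: contra (preserver0_neq0 x'0 y0) => /eqP h.
      by rewrite e1 h mulmx0.
    have [c ec] : cpar w u' by exact: (cpar_eq hE b10 (etrans (esym e1) e2)).
    by have [b ->] := hu' y'; exists (c *m b); rewrite ec mulmxA.
  have [b eb] := hall x1 y1.
  (* The row only has to be nonzero, and [b] is, as a factor of a nonzero image. *)
  exists w, b; split=> // [|x' y']; last by left.
  by apply: contra (preserver0_neq0 x10 y10) => /eqP h; rewrite eb h mulmx0.
have hL x : x != 0 -> exists2 v : 'rV_q, v != 0 &
    forall a, exists b, phi (x *m a) = b *m v.
  by move=> x0; case: (clique_L x0) => // h; case: nL; exists x.
constructor 3; split=> // y y0.
case: (clique_R y0) => // -[w w0 hw]; case: ndeg.
have hall x' y' : exists b, phi (x' *m y') = b *m w.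
  case: (eqVneq x' 0) => [->|x'0].
    by exists 0; rewrite !mul0mx.
  have [u' u'0 hu'] := hL _ x'0; have [b1 e1] := hu' y; have [b2 e2] := hw x'.
  have b10 : b1 != 0.
    apply: contra (preserver0_neq0 x'0 y0) => /eqP h.
    by rewrite e1 h mul0mx.
  have [c ec] : rpar w u' by exact: (rpar_eq hE b10 (etrans (esym e1) e2)).
  by have [b ->] := hu' y'; exists (b *m c); rewrite ec mulmxA.
have [b eb] := hall x1 y1.
exists b, w; split=> // [|x' y']; last by right.
by apply: contra (preserver0_neq0 x10 y10) => /eqP h; rewrite eb h mul0mx.
Qed.

End AtZero.
End CliqueTypes.

(** * Matrices of rank two and propagation of alignment *)

Section AlignedRank2.
Variables D E : unitRingType.
Hypotheses (hD : division_ring D) (hE : division_ring E).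
(* Some arguments need a third point on each line; only the case of a
   two-element [D] with a larger [E] is excluded. *)
Hypothesis hcard : (exists d : 'M[D]_1, d != 0 /\ d != 1%:M) \/
  (forall e : 'M[E]_1, e = 0 \/ e = 1%:M).
Variables m n p q : nat.
Hypotheses (hm : (0 < m)%N) (hn : (0 < n)%N).
Implicit Types (x : 'cV[D]_m) (y : 'rV[D]_n) (u : 'cV[E]_p) (v : 'rV[E]_q).

Section Fixed.
Variables (phi : 'M[D]_(m, n) -> 'M[E]_(p, q)).
Variables (f : 'cV[D]_m -> 'cV[E]_p) (g : 'rV[D]_n -> 'rV[E]_q).
Hypotheses (hphi : rk1_preserver phi) (phi0 : phi 0 = 0).
Hypothesis al : aligned phi f g.

Lemma aligned_rk1 x y : x != 0 -> y != 0 ->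
  exists2 c : 'M[E]_1, c != 0 & phi (x *m y) = f x *m c *m g y.
Proof.
move=> x0 y0; have [b e] := al_L al x0 y; have [b' e'] := al_R al y0 x.
have [c ec] : rpar (g y) b.
  exact: (rpar_eq hE (al_f0 al x0) (etrans (esym e) e')).
exists c; last by rewrite e ec mulmxA.
have := preserver0_neq0 hD hphi phi0 x0 y0.
by apply: contra => /eqP c0; rewrite e ec c0 mul0mx mulmx0.
Qed.

Lemma aligned_cpar x y u b :
  x != 0 -> y != 0 -> phi (x *m y) = u *m b -> cpar u (f x).
Proof.
move=> x0 y0; have [c c0 ->] := aligned_rk1 x0 y0; rewrite -mulmxA.
by apply: cpar_eq => //; apply: mulmx_1r_neq0 => //; apply: al_g0 al _ y0.
Qed.

Lemma aligned_rpar x y v b :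
  x != 0 -> y != 0 -> phi (x *m y) = b *m v -> rpar v (g y).
Proof.
move=> x0 y0; have [c c0 ->] := aligned_rk1 x0 y0.
by apply: rpar_eq => //; apply: mulmx_c1_neq0 => //; apply: al_f0 al _ x0.
Qed.

Lemma aligned_fZ x (c : 'M_1) : x != 0 -> c != 0 -> cpar (f x) (f (x *m c)).
Proof.
move=> x0 c0; have [y y0] := ex_rV_neq0 D hn.
have [b e] := al_L al x0 (c *m y).
apply: (aligned_cpar (y := y) (b := b)) => //.
  exact: mulmx_c1_neq0.
by rewrite -mulmxA.
Qed.

Lemma aligned_gZ y (c : 'M_1) : y != 0 -> c != 0 -> rpar (g y) (g (c *m y)).
Proof.
move=> y0 c0; have [x x0] := ex_cV_neq0 D hm.
have [b e] := al_R al y0 (x *m c).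
apply: (aligned_rpar (x := x) (b := b)) => //.
  exact: mulmx_1r_neq0.
by rewrite mulmxA.
Qed.

Lemma aligned_csym x1 x2 : x1 != 0 -> x2 != 0 ->
  cpar (f x1) (f x2) -> cpar (f x2) (f x1).
Proof. by move=> x10 x20; apply: cpar_sym => //; apply: al_f0 al _ x20. Qed.

Lemma aligned_rsym y1 y2 : y1 != 0 -> y2 != 0 ->
  rpar (g y1) (g y2) -> rpar (g y2) (g y1).
Proof. by move=> y10 y20; apply: rpar_sym => //; apply: al_g0 al _ y20. Qed.

Lemma fpar_addr_neq0 x1 x2 (c : 'M_1) : x1 != 0 -> x2 != 0 ->
  ~ cpar (f x1) (f x2) -> x1 + x2 *m c != 0.
Proof.
move=> x10 x20 n12; apply/eqP => /eqP; rewrite addr_eq0 => /eqP e; apply: n12.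
have c0 : - c != 0.
  by apply: contra x10 => /eqP c0; rewrite e -mulmxN c0 mulmx0.
by apply: aligned_csym => //; rewrite e -mulmxN; apply: aligned_fZ.
Qed.

Lemma gpar_addr_neq0 y1 y2 (c : 'M_1) : y1 != 0 -> y2 != 0 ->
  ~ rpar (g y1) (g y2) -> y1 + c *m y2 != 0.
Proof.
move=> y10 y20 n12; apply/eqP => /eqP; rewrite addr_eq0 => /eqP e; apply: n12.
have c0 : - c != 0.
  by apply: contra y10 => /eqP c0; rewrite e -mulNmx c0 mul0mx.
by apply: aligned_rsym => //; rewrite e -mulNmx; apply: aligned_gZ.
Qed.

Lemma aligned_adj A x y u v : phi A = u *m v -> u != 0 -> v != 0 ->
  x != 0 -> y != 0 -> rk1 (A - x *m y) -> cpar u (f x) \/ rpar v (g y).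
Proof.
move=> eA u0 v0 x0 y0 /(preserver_rk1 hphi); rewrite eA.
have [c c0 ->] := aligned_rk1 x0 y0.
move=> /(rk1_sub_par hE u0 (al_g0 al y0)) [h|h]; last first.
  by right; apply: rpar_sym.
have [d [cd _]] := mx11_inv hE c0; left; apply: cpar_trans h _.
by exists d; rewrite -mulmxA cd mulmx1.
Qed.

(* On the lines (x1 x2) and (y1 y2), [f] takes the value f(x1) except possibly
   at x2, and [g] the value g(y2) except possibly at y1. *)
Let tilted x1 x2 y1 y2 : Prop :=
  (forall c : 'M_1, cpar (f x1) (f (x1 + x2 *m c))) /\
  (forall c : 'M_1, rpar (g y2) (g (y2 + c *m y1))).

Section Pair.
Variables (x1 x2 : 'cV[D]_m) (y1 y2 : 'rV[D]_n).
Hypotheses (x10 : x1 != 0) (x20 : x2 != 0) (y10 : y1 != 0) (y20 : y2 != 0).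
Hypotheses (nf : ~ cpar (f x1) (f x2)) (ng : ~ rpar (g y1) (g y2)).

Let nf' : ~ cpar (f x2) (f x1).
Proof. by move=> /(aligned_csym x20 x10). Qed.

Let ng' : ~ rpar (g y2) (g y1).
Proof. by move=> /(aligned_rsym y20 y10). Qed.

(** The matrices (x1 + x2 c) y1, x2 (y2 + c y1) and their mirror images differ from x1 y1 + x2 y2 by
    rank at most one. By the separation hypotheses [u] matches exactly one of f(x1), f(x2), and [v]
    matches g(y) for the other index; the covering alternative then freezes [f] and [g] along these
    lines. *)
Lemma tilted_of_cover u v : u != 0 -> v != 0 ->
  (forall x y, x != 0 -> y != 0 -> rk1 (x1 *m y1 + x2 *m y2 - x *m y) ->
    cpar u (f x) \/ rpar v (g y)) ->
  tilted x1 x2 y1 y2 \/ tilted x2 x1 y2 y1.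
Proof.
move=> u0 v0 H.
have fsym x : x != 0 -> cpar u (f x) -> cpar (f x) u.
  by move=> x0; apply: cpar_sym => //; apply: al_f0 al _ x0.
have gsym y : y != 0 -> rpar v (g y) -> rpar (g y) v.
  by move=> y0; apply: rpar_sym => //; apply: al_g0 al _ y0.
have H1 : cpar u (f x1) \/ rpar v (g y1).
  by apply: H => //; rewrite addrC addKr; exists x2, y2.
have H2 : cpar u (f x2) \/ rpar v (g y2).
  by apply: H => //; rewrite addrK; exists x1, y1.
have K1 c : cpar u (f (x1 + x2 *m c)) \/ rpar v (g y1).
  apply: H => //; first exact: fpar_addr_neq0.
  exists x2, (y2 - c *m y1).
  by rewrite mulmxDl mulmxBr opprD addrACA subrr add0r mulmxA.
have K2 c : cpar u (f (x2 + x1 *m c)) \/ rpar v (g y2).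
  apply: H => //; first exact: fpar_addr_neq0.
  exists x1, (y1 - c *m y2); rewrite [_ + _ *m y2]addrC.
  by rewrite mulmxDl mulmxBr opprD addrACA subrr add0r mulmxA.
have G1 c : cpar u (f x2) \/ rpar v (g (y2 + c *m y1)).
  apply: H => //; first exact: gpar_addr_neq0.
  exists (x1 - x2 *m c), y1; rewrite [_ + _ *m y2]addrC.
  by rewrite mulmxDr mulmxBl opprD addrACA subrr add0r mulmxA.
have G2 c : cpar u (f x1) \/ rpar v (g (y1 + c *m y2)).
  apply: H => //; first exact: gpar_addr_neq0.
  exists (x2 - x1 *m c), y2.
  by rewrite mulmxDr mulmxBl opprD addrACA subrr add0r mulmxA.
case: H1 => h1; case: H2 => h2.
- by case: nf; apply: cpar_trans (fsym _ x10 h1) h2.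
- left; split=> c.
    case: (K1 c) => [h|h]; first exact: cpar_trans (fsym _ x10 h1) h.
    by case: ng'; apply: rpar_trans (gsym _ y20 h2) h.
  case: (G1 c) => [h|h]; last exact: rpar_trans (gsym _ y20 h2) h.
  by case: nf; apply: cpar_trans (fsym _ x10 h1) h.
- right; split=> c.
    case: (K2 c) => [h|h]; first exact: cpar_trans (fsym _ x20 h2) h.
    by case: ng; apply: rpar_trans (gsym _ y10 h1) h.
  case: (G2 c) => [h|h]; last exact: rpar_trans (gsym _ y10 h1) h.
  by case: nf'; apply: cpar_trans (fsym _ x20 h2) h.
- by case: ng; apply: rpar_trans (gsym _ y10 h1) h2.
Qed.

(** If phi(A) is nonzero, being adjacent to it gives the cover. If phi(A) = 0, the cliques through A
    are classified: the degenerate type again gives a cover, the other two contradict separation. *)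
Lemma tilted_of_rk1 : rk1 (phi (x1 *m y1 + x2 *m y2)) ->
  tilted x1 x2 y1 y2 \/ tilted x2 x1 y2 y1.
Proof.
set A := _ + _ => -[b [c eA]].
have [A0|A0] := eqVneq (phi A) 0; last first.
  have b0 : b != 0 by apply: contra A0 => /eqP h; rewrite eA h mul0mx.
  have c0 : c != 0 by apply: contra A0 => /eqP h; rewrite eA h mulmx0.
  apply: (tilted_of_cover b0 c0) => x y x0 y0 hxy.
  exact: (aligned_adj eA).
have phiA X : recenter phi A X = phi (A + X) by rewrite /recenter A0 subr0.
have A1 : A - x1 *m y1 = x2 *m y2 by rewrite /A addrC addKr.
have A2 : A - x2 *m y2 = x1 *m y1 by rewrite /A addrK.
have s0 : x2 + x1 != 0.
  by rewrite -[x1]mulmx1; apply: fpar_addr_neq0.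
have := clique_types hD hE hm hn (recenter_preserver A hphi)
  (recenter0 phi A).
case=> [[u [v [u0 v0 H]]]|[f' [g' al']]|[H1 H2]].
- apply: (tilted_of_cover u0 v0) => x y x0 y0 [a [z exy]].
  have := H (- a) z; rewrite phiA mulNmx -exy subKr => -[[w ew]|[w ew]].
    by left; apply: aligned_cpar ew.
  by right; apply: aligned_rpar ew.
(* Aligned at A: the translate of L(x2) through A contains x1 y1 and (x1 + x2) y1, that of L(x1)
   contains x2 y2 and (x1 + x2) y2. Hence f(x1), f(x1 + x2) and f(x2) are parallel. *)
- case: nf; apply: (@cpar_trans _ _ _ (f' x2)).
    have [w] := al_L al' x20 (- y2); rewrite phiA mulmxN A2 => ew.
    by apply: cpar_sym (aligned_cpar x10 y10 ew) => //; apply: al_f0 al _ x10.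
  apply: (@cpar_trans _ _ _ (f (x2 + x1))).
    have [w] := al_L al' x20 (y1 - y2).
    rewrite phiA mulmxBr addrCA A2 -mulmxDl => ew.
    exact: aligned_cpar ew.
  apply: (@cpar_trans _ _ _ (f' x1)).
    have [w] := al_L al' x10 (y2 - y1).
    rewrite phiA mulmxBr addrCA A1 -mulmxDl addrC => ew.
    by apply: cpar_sym (aligned_cpar s0 y20 ew) => //; apply: al_f0 al _ s0.
  have [w] := al_L al' x10 (- y1); rewrite phiA mulmxN A1 => ew.
  exact: aligned_cpar ew.
(* Opposite type at A: A + x1 y2 goes into both R(v) and L(u), with [v] on the line of g(y2) and [u]
   on that of f(x1). But it differs from (- x2) y1 by (x1 + x2) (y1 + y2), so it would have to share
   a line with f(- x2) or g(y1). *)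
have [v v0 hv] := H1 _ x10; have [u u0 hu] := H2 _ y20.
have gv : rpar v (g y2).
  have [w] := hv (- y1); rewrite phiA mulmxN A1 => ew.
  exact: aligned_rpar ew.
have fu : cpar u (f x1).
  have [w] := hu (- x2); rewrite phiA mulNmx A2 => ew.
  exact: aligned_cpar ew.
have C0 : phi (A + x1 *m y2) != 0.
  rewrite -phiA; apply: preserver0_neq0 => //; first exact: recenter_preserver.
  exact: recenter0.
have [w1] := hv y2; have [w2] := hu x1; rewrite !phiA => e2 e1.
have w20 : w2 != 0 by apply: contra C0 => /eqP h; rewrite e2 h mulmx0.
have vw2 : rpar v w2 by apply: (rpar_eq hE u0 (etrans (esym e2) e1)).
have : rk1 (A + x1 *m y2 - (- x2) *m y1).
  exists (x1 + x2), (y1 + y2); rewrite mulNmx opprK /A mulmxDl !mulmxDr.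
  by rewrite -!addrA; congr (_ + _); rewrite addrC -addrA.
case/(aligned_adj e2 u0 w20); rewrite ?oppr_eq0 // => h.
  case: nf; apply: cpar_trans (cpar_sym hE (al_f0 al x10) fu) _.
  have e : x2 = - x2 *m - 1%:M by rewrite mulNmx mulmxN opprK mulmx1.
  apply: cpar_trans h _; rewrite [X in cpar _ (f X)]e.
  by apply: aligned_fZ; rewrite oppr_eq0 //; apply: mx11_neq0.
case: ng'; apply: rpar_trans (rpar_sym hE (al_g0 al y20) gv) _.
exact: rpar_trans vw2 h.
Qed.

End Pair.

Section NotTilted.
Variables (x1 x2 : 'cV[D]_m) (y1 y2 : 'rV[D]_n).
Hypotheses (x10 : x1 != 0) (x20 : x2 != 0) (y10 : y1 != 0) (y20 : y2 != 0).
Hypotheses (nf : ~ cpar (f x1) (f x2)) (ng : ~ rpar (g y1) (g y2)).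

(* [x2 y1 + x1 y2] is shown to be sent to a matrix of rank one; applied to it,
   [tilted_of_rk1] gives tilts incompatible with the given one. *)
Lemma not_tilted : ~ tilted x1 x2 y1 y2.
Proof.
case=> f1 g2.
have n1 : (1%:M : 'M[D]_1) != 0 by apply: mx11_neq0.
have nf' : ~ cpar (f x2) (f x1) by move=> /(aligned_csym x20 x10).
have ng' : ~ rpar (g y2) (g y1) by move=> /(aligned_rsym y20 y10).
have s0 : x1 + x2 != 0 by rewrite -[x2]mulmx1; apply: fpar_addr_neq0.
have t0 : y1 + y2 != 0 by rewrite -[y2]mul1mx; apply: gpar_addr_neq0.
have fs : cpar (f x1) (f (x1 + x2)) by rewrite -[x2 in x1 + x2]mulmx1.
have gs : rpar (g y2) (g (y1 + y2)).
  by rewrite addrC -[y1 in _ + y1]mul1mx.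
suff : rk1 (phi (x2 *m y1 + x1 *m y2)).
  case/(tilted_of_rk1 x20 x10 y10 y20 nf' ng) => -[h1 h2].
    apply: nf'; apply: cpar_trans (aligned_csym x10 s0 fs).
    by rewrite addrC -[x1 in _ + x1]mulmx1.
  apply: ng'; apply: rpar_trans gs _; apply: aligned_rsym => //.
  by rewrite -[y2 in _ + y2]mul1mx.
(* As y1 + t y2 = t (y2 + t^-1 y1), the tilt puts its image under [g] on the line of g(y2). *)
have gt (t : 'M_1) : t != 0 -> exists2 e : 'M[E]_1, e != 0 &
    phi (x2 *m (y1 + t *m y2)) = f x2 *m (e *m g y2).
  move=> tn0; have [t' [tt' t't]] := mx11_inv hD tn0.
  have yt0 : y1 + t *m y2 != 0 by apply: gpar_addr_neq0.
  have [c c0 ->] := aligned_rk1 x20 yt0.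
  have [d ed] : rpar (g y2) (g (y1 + t *m y2)).
    apply: rpar_trans (g2 t') _.
    have -> : y1 + t *m y2 = t *m (y2 + t' *m y1).
      by rewrite mulmxDr mulmxA tt' mul1mx addrC.
    by apply: aligned_gZ => //; apply: gpar_addr_neq0.
  exists (c *m d); last by rewrite ed !mulmxA.
  apply: mulmx_c1_neq0 => //; apply: contra (al_g0 al yt0) => /eqP d0.
  by rewrite ed d0 mul0mx.
have [c c0 e21] := aligned_rk1 x20 y10.
have [c' [cc' c'c]] := mx11_inv hE c0.
have [r rf] := col_linv hE (al_f0 al x20).
have p0 := recenter_preserver (x2 *m y1) hphi.
have [[u u0 hu]|[v v0 hv]] :=
    clique_R hD hE hm p0 (recenter0 phi (x2 *m y1)) y20.
  have [b] := hu x2; have [e e0] := gt _ n1; rewrite mul1mx.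
  rewrite /recenter -mulmxDr => -> eb.
  have [d ed] : cpar (f x2) u.
    apply: cpar_sym => //; first exact: al_f0 al _ x20.
    apply: (@cpar_eq _ hE _ _ _ _ (e *m g y2 - c *m g y1) b); last first.
      by rewrite -eb e21 mulmxBr !mulmxA.
    rewrite subr_eq0; apply/negP => /eqP h; apply: ng'.
    by exists (c' *m e); rewrite -mulmxA h mulmxA c'c mul1mx.
  (* Since [u] is on the line of f(x2), the whole clique, and x2 y1 + x1 y2 in particular, goes into
     L(f(x2)). *)
  have [b'] := hu x1; rewrite /recenter => /eqP; rewrite subr_eq => /eqP ->.
  by exists (f x2), (d *m b' + c *m g y1); rewrite ed e21 mulmxDr !mulmxA.
have key t : t != 0 -> exists e k : 'M[E]_1,
    phi (x2 *m (y1 + t *m y2)) = f x2 *m (e *m g y2) /\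
    e *m g y2 - c *m g y1 = k *m v.
  move=> tn0; have [e e0 ee] := gt _ tn0; exists e.
  have [b] := hv (x2 *m t); rewrite /recenter -mulmxA -mulmxDr ee e21 => h.
  exists (r *m b); split=> //.
  by rewrite -mulmxA -h mulmxBr !mulmxA rf !mul1mx.
(* The values 1 and d of t give two distinct points e g(y2) - c g(y1) on the line of [v]; their
   difference puts g(y2) on it, and then g(y1) too. If every scalar of E is 0 or 1, phi would
   identify x2 (y1 + y2) with x2 y2. *)
case: hcard => [[d [d0 d1]]|E01].
  have [e1 [k1 [E1 K1]]] := key _ n1; have [e2 [k2 [E2 K2]]] := key _ d0.
  have e12 : e1 - e2 != 0.
    rewrite subr_eq0; apply: contraTneq isT => e12.
    have : phi (x2 *m (y1 + 1%:M *m y2)) != phi (x2 *m (y1 + d *m y2)).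
      apply: (hphi _ _).1.
        rewrite -subr_eq0 -mulmxBr opprD addrACA subrr add0r -mulmxBl.
        apply: mulmx_cr_neq0 => //; apply: mulmx_1r_neq0 => //.
        by rewrite subr_eq0 eq_sym.
      by rewrite -mulmxBr; exists x2, (y1 + 1%:M *m y2 - (y1 + d *m y2)).
    by rewrite E1 E2 e12 eqxx.
  have vg2 : rpar v (g y2).
    apply: (@rpar_eq _ hE _ _ (e1 - e2) (k1 - k2)) => //.
    by rewrite !mulmxBl -K1 -K2 opprB addrA subrK.
  case: ng'; apply: rpar_trans (rpar_sym hE (al_g0 al y20) vg2) _.
  have [w ew] := vg2; exists (c' *m (e1 *m w - k1)).
  rewrite -mulmxA mulmxBl -mulmxA -ew -K1 opprB addrCA subrr addr0.
  by rewrite mulmxA c'c mul1mx.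
have [a a0 ea] := aligned_rk1 x20 y20.
have [e e0 ee] := gt _ n1.
have one (z : 'M[E]_1) : z != 0 -> z = 1%:M.
  by case: (E01 z) => -> //; rewrite eqxx.
have : phi (x2 *m (y1 + 1%:M *m y2)) != phi (x2 *m y2).
  apply: (hphi _ _).1.
    rewrite -subr_eq0 -mulmxBr mul1mx addrK.
    exact: mulmx_cr_neq0.
  by rewrite -mulmxBr mul1mx addrK; exists x2, y1.
by rewrite ee ea (one _ e0) (one _ a0) mulmx1 mul1mx eqxx.
Qed.

End NotTilted.

Lemma aligned_rank2 x1 x2 y1 y2 :
  x1 != 0 -> x2 != 0 -> y1 != 0 -> y2 != 0 ->
  ~ cpar (f x1) (f x2) -> ~ rpar (g y1) (g y2) ->
  ~ rk1 (phi (x1 *m y1 + x2 *m y2)).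
Proof.
move=> x10 x20 y10 y20 nf ng.
case/(tilted_of_rk1 x10 x20 y10 y20 nf ng); first exact: not_tilted.
apply: not_tilted => //; first by move=> /(aligned_csym x20 x10).
by move=> /(aligned_rsym y20 y10).
Qed.

(** L(x1) is the same clique seen from 0 and from x1 y1, which excludes the opposite type. In the
    degenerate type [u] and [v] are forced onto the lines of f(x1) and g(y1), and then x1 y1 + x2 y2
    would go to rank one. *)
Lemma recenter_aligned1 x1 y1 :
  x1 != 0 -> y1 != 0 -> is_aligned (recenter phi (x1 *m y1)).
Proof.
move=> x10 y10; have [x2 x20 nf] := al_f al (al_f0 al x10).
have [y2 y20 ng] := al_g al (al_g0 al y10).
set A := x1 *m y1; have pA := recenter_preserver A hphi.
have [c c0 ec] := aligned_rk1 x10 y10.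
have [c' c'0 ec'] := aligned_rk1 x10 y20.
have f10 := al_f0 al x10; have g10 := al_g0 al y10.
have eN : recenter phi A (x1 *m - y1) = - (f x1 *m c *m g y1).
  by rewrite /recenter mulmxN subrr phi0 sub0r -ec.
have eX : recenter phi A (x1 *m (y2 - y1)) = f x1 *m (c' *m g y2 - c *m g y1).
  by rewrite /recenter -mulmxDr [y1 + _]addrC subrK ec ec' mulmxBr !mulmxA.
have [c2 c20 ec2] := aligned_rk1 x20 y10.
have eN' : recenter phi A (- x1 *m y1) = - (f x1 *m c *m g y1).
  by rewrite /recenter mulNmx subrr phi0 sub0r -ec.
have eX' : recenter phi A ((x2 - x1) *m y1) = (f x2 *m c2 - f x1 *m c) *m g y1.
  by rewrite /recenter -mulmxDl [x1 + _]addrC subrK ec ec2 mulmxBl.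
have nof u : u != 0 -> cpar u (f x1) -> ~ cpar u (f x2 *m c2 - f x1 *m c).
  move=> u0 h1 [w ew]; apply: nf.
  have [d [dc2 _]] := mx11_inv hE c20.
  have [k ek] := cpar_sym hE f10 h1.
  exists ((k *m w + c) *m d).
  by rewrite mulmxA mulmxDr mulmxA -ek -ew subrK -mulmxA dc2 mulmx1.
have nog v : v != 0 -> rpar v (g y1) -> ~ rpar v (c' *m g y2 - c *m g y1).
  move=> v0 h1 [w ew]; apply: ng.
  have [d [_ dc']] := mx11_inv hE c'0.
  have [k ek] := rpar_sym hE g10 h1.
  exists (d *m (w *m k + c)).
  by rewrite -mulmxA mulmxDl -(mulmxA w) -ek -ew subrK mulmxA dc' mul1mx.
case: (clique_types hD hE hm hn pA (recenter0 phi A)) => //.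
- case=> u [v [u0 v0 H]].
  (* The points 0 and x1 y2 of L(x1) are tested. If 0 is covered by R(v), then [v] is on the line of
     g(y1), so x1 y2 can only be covered by L(u). *)
  have fu : cpar u (f x1).
    case: (H x1 (- y1)) => -[b]; rewrite eN.
      rewrite -mulmxA -mulmxN; apply: cpar_eq => //.
      by rewrite oppr_eq0; apply: mulmx_1r_neq0.
    rewrite -mulNmx => /(rpar_eq hE _) vg.
    have {}vg : rpar v (g y1).
      by apply: vg; rewrite oppr_eq0; apply: mulmx_c1_neq0.
    case: (H x1 (y2 - y1)) => -[b']; rewrite eX.
      apply: cpar_eq => //; apply: contra_not_neq (nog _ v0 vg) => ->.
      by exists 0; rewrite mul0mx.
    by move/(rpar_eq hE f10)/(nog _ v0 vg).
  have gv : rpar v (g y1).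
    case: (H (- x1) y1) => -[b]; rewrite eN'; last first.
      rewrite -mulNmx; apply: rpar_eq => //.
      by rewrite oppr_eq0; apply: mulmx_c1_neq0.
    rewrite -mulmxA -mulmxN => /(cpar_eq hE _) ug.
    have {}ug : cpar u (f x1).
      by apply: ug; rewrite oppr_eq0; apply: mulmx_1r_neq0.
    case: (H (x2 - x1) y1) => -[b']; rewrite eX'; last first.
      apply: rpar_eq => //; apply: contra_not_neq (nof _ u0 ug) => ->.
      by exists 0; rewrite mulmx0.
    by move/(cpar_eq hE g10)/(nof _ u0 ug).
  case: (aligned_rank2 x10 x20 y10 y20 nf ng).
  case: (H x2 y2) => -[b /eqP]; rewrite subr_eq => /eqP ->; rewrite ec.
    have [k' ek'] := cpar_sym hE f10 fu.
    exists (f x1), (k' *m b + c *m g y1).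
    by rewrite mulmxDr !mulmxA -ek'.
  have [l' el'] := rpar_sym hE g10 gv.
  exists (b *m l' + f x1 *m c), (g y1).
  by rewrite mulmxDl -(mulmxA b) -el'.
- case=> hL _; have [v v0 hv] := hL _ x10.
  have [b] := hv (- y1); rewrite eN -mulNmx => /(rpar_eq hE _) vg.
  have [b'] := hv (y2 - y1); rewrite eX => /(rpar_eq hE f10).
  move/(nog _ v0 _) => []; apply: vg.
  by rewrite oppr_eq0; apply: mulmx_c1_neq0.
Qed.

End Fixed.
End AlignedRank2.

(** * Transposition into the converse ring *)

Lemma mulmx_trc (D : nzRingType) m n p (A : 'M[D]_(m, n)) (B : 'M[D]_(n, p)) :
  (B^T : 'M[D^c]_(p, n)) *m (A^T : 'M[D^c]_(n, m)) =
  ((A *m B)^T : 'M[D^c]_(p, m)).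
Proof. by rewrite trmx_mul_rev. Qed.

Lemma trmx_mulc (D : nzRingType) m n p
    (A : 'M[D^c]_(m, n)) (B : 'M[D^c]_(n, p)) :
  (A *m B)^T = (B^T : 'M[D]_(p, n)) *m (A^T : 'M[D]_(n, m)) :> 'M[D]_(p, m).
Proof.
by apply/matrixP=> k i; rewrite !mxE; apply: eq_bigr => j _; rewrite !mxE.
Qed.

(** Source and target are transposed together: L and R are exchanged at both ends, alignment
    survives, and a statement about columns yields the one about rows or conversely. *)
Definition transposed (D E : nzRingType) m n p q
    (phi : 'M[D]_(m, n) -> 'M[E]_(p, q)) (X : 'M[D^c]_(n, m)) :
    'M[E^c]_(q, p) :=
  (phi (X^T : 'M[D]_(m, n)))^T.

Lemma rk1_trc (D : nzRingType) p q (X : 'M[D]_(p, q)) :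
  rk1 X -> rk1 (X^T : 'M[D^c]_(q, p)).
Proof. by case=> u [v ->]; exists v^T, u^T; rewrite mulmx_trc. Qed.

Lemma rk1_ctr (D : nzRingType) p q (X : 'M[D^c]_(p, q)) :
  rk1 X -> rk1 (X^T : 'M[D]_(q, p)).
Proof. by case=> u [v ->]; exists v^T, u^T; rewrite trmx_mulc. Qed.

Lemma cpar_tr (D : nzRingType) p (u v : 'cV[D]_p) :
  rpar (u^T : 'rV[D^c]_p) (v^T : 'rV[D^c]_p) -> cpar u v.
Proof.
case=> c e; exists (c^T : 'M[D]_1); apply: trmx_inj.
by rewrite -[RHS](mulmx_trc u) trmxK e.
Qed.

Lemma rpar_tr (D : nzRingType) p (u v : 'rV[D]_p) :
  cpar (u^T : 'cV[D^c]_p) (v^T : 'cV[D^c]_p) -> rpar u v.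
Proof.
case=> c e; exists (c^T : 'M[D]_1); apply: trmx_inj.
by rewrite -[RHS](mulmx_trc _ u) trmxK e.
Qed.

Lemma tr_cpar (D : nzRingType) p (u v : 'cV[D]_p) :
  cpar u v -> rpar (u^T : 'rV[D^c]_p) (v^T : 'rV[D^c]_p).
Proof. by case=> c ->; exists (c^T : 'M[D^c]_1); rewrite mulmx_trc. Qed.

Lemma trmx_neq0 (V : nmodType) p q (X : 'M[V]_(p, q)) : (X^T != 0) = (X != 0).
Proof. by rewrite -[in RHS](inj_eq (@trmx_inj _ _ _)) trmx0. Qed.

Section Transposed.
Variables D E : nzRingType.
Variables m n p q : nat.
Variable phi : 'M[D]_(m, n) -> 'M[E]_(p, q).

Lemma transposed_preserver :
  rk1_preserver phi -> rk1_preserver (transposed phi).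
Proof.
move=> h A B AB AB1; have [||h1 h2] := h A^T B^T.
- by apply: contra AB => /eqP/trmx_inj ->.
- by have := rk1_ctr AB1; rewrite linearB.
split; first by apply: contra h1 => /eqP/trmx_inj ->.
by have := rk1_trc h2; rewrite linearB.
Qed.

Lemma transposed_aligned f g : aligned phi f g ->
  aligned (transposed phi) (fun x => (g (x^T : 'rV[D]_n))^T)
    (fun y => (f (y^T : 'cV[D]_m))^T).
Proof.
case=> f0 g0 hL hR hf hg; split.
- by move=> x x0; rewrite trmx_neq0; apply: g0; rewrite trmx_neq0.
- by move=> x x0; rewrite trmx_neq0; apply: f0; rewrite trmx_neq0.
- move=> x x0 a; have [|b e] := hR x^T _ a^T; first by rewrite trmx_neq0.
  by exists b^T; rewrite mulmx_trc -e /transposed trmx_mulc.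
- move=> x x0 a; have [|b e] := hL x^T _ a^T; first by rewrite trmx_neq0.
  by exists b^T; rewrite mulmx_trc -e /transposed trmx_mulc.
- move=> u u0; have [|y y0 ny] := hg u^T; first by rewrite trmx_neq0.
  exists y^T; first by rewrite trmx_neq0.
  rewrite trmxK => h; apply: ny; apply: rpar_tr.
  by rewrite trmxK.
- move=> u u0; have [|y y0 ny] := hf u^T; first by rewrite trmx_neq0.
  exists y^T; first by rewrite trmx_neq0.
  rewrite trmxK => h; apply: ny; apply: cpar_tr.
  by rewrite trmxK.
Qed.
End Transposed.

(** * Alignment at every base point *)

Lemma mx_rk1_ind (D : nzRingType) m n (P : 'M[D]_(m, n) -> Prop) :
  P 0 -> (forall A (x : 'cV_m) (y : 'rV_n), P A -> P (A + x *m y)) ->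
  forall A, P A.
Proof.
move=> P0 PS A; have -> : A = \sum_i delta_mx i (0 : 'I_1) *m row i A.
  apply/matrixP=> i j; rewrite summxE (bigD1 i) //=.
  rewrite big1 => [|k ki]; rewrite !mxE big_ord1 !mxE !eqxx ?andbT.
    by rewrite mul1r addr0.
  by rewrite eq_sym (negPf ki) mul0r.
by elim/big_rec: _ => // i B _ PB; rewrite addrC; apply: PS.
Qed.

Lemma aligned_ext (D E : nzRingType) m n p q
    (phi psi : 'M[D]_(m, n) -> 'M[E]_(p, q)) :
  phi =1 psi -> is_aligned phi -> is_aligned psi.
Proof.
move=> e [f [g [f0 g0 hL hR hf hg]]]; exists f, g; split=> // [x x0|y y0] a.
  by rewrite -e; apply: hL.
by rewrite -e; apply: hR.
Qed.

Definition everywhere_aligned (D E : nzRingType) m n p q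
    (phi : 'M[D]_(m, n) -> 'M[E]_(p, q)) : Prop :=
  forall A, is_aligned (recenter phi A).

Lemma transposed_everywhere_aligned (D E : nzRingType) m n p q
    (phi : 'M[D]_(m, n) -> 'M[E]_(p, q)) :
  everywhere_aligned phi -> everywhere_aligned (transposed phi).
Proof.
move=> h A; apply: (@aligned_ext _ _ _ _ _ _ (transposed (recenter phi A^T))).
  by move=> X; rewrite /transposed /recenter !linearB !linearD.
have [f [g al]] := h A^T; exists (fun x => (g (x^T : 'rV[D]_n))^T).
exists (fun y => (f (y^T : 'cV[D]_m))^T); exact: transposed_aligned.
Qed.

Section Everywhere.
Variables D E : unitRingType.
Hypotheses (hD : division_ring D) (hE : division_ring E).
Hypothesis hcard : (exists d : 'M[D]_1, d != 0 /\ d != 1%:M) \/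
  (forall e : 'M[E]_1, e = 0 \/ e = 1%:M).
Variables m n p q : nat.
Hypotheses (hm : (0 < m)%N) (hn : (0 < n)%N).
Implicit Types (x : 'cV[D]_m) (y : 'rV[D]_n) (u : 'cV[E]_p) (v : 'rV[E]_q).
Variables (phi : 'M[D]_(m, n) -> 'M[E]_(p, q)).
Hypotheses (hphi : rk1_preserver phi) (phi0 : phi 0 = 0).

(** Every matrix is reached from 0 by rank one steps, and [recenter_aligned1] carries alignment
    across each step. *)
Lemma aligned_everywhere : is_aligned phi -> everywhere_aligned phi.
Proof.
move=> al; apply: mx_rk1_ind => [|A x y [f [g alA]]].
  by apply: aligned_ext al => X; rewrite /recenter add0r phi0 subr0.
have e0 X : recenter phi A X = recenter phi (A + 0) X by rewrite addr0.
have [->|x0] := eqVneq x 0; first by rewrite mul0mx addr0; exists f, g.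
have [->|y0] := eqVneq y 0; first by rewrite mulmx0 addr0; exists f, g.
have pA := recenter_preserver A hphi.
apply: aligned_ext (recenter_aligned1 hD hE hcard hm hn pA _ alA x0 y0).
  by move=> X; rewrite /recenter !addrA opprB addrA subrK.
exact: recenter0.
Qed.

Variables (f : 'cV[D]_m -> 'cV[E]_p) (g : 'rV[D]_n -> 'rV[E]_q).
Hypotheses (al : aligned phi f g) (eal : everywhere_aligned phi).

(* For [e] outside {0, 1}, the point y3 + y4 lies on the line through
   (1 - e^-1) y3 and (1 - e) y4, and this line is sent to a line. *)
Lemma gpar_add y3 y4 : y3 != 0 -> y4 != 0 -> y3 + y4 != 0 ->
  rpar (g y3) (g y4) -> rpar (g y3) (g (y3 + y4)).
Proof.
move=> y30 y40 s0 h34; have [x x0] := ex_cV_neq0 D hm.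
have [par|npar] := classic (rpar y3 y4).
  have [c ec] := par; have e : y3 + y4 = (1%:M + c) *m y3.
    by rewrite mulmxDl mul1mx ec.
  rewrite e; apply: (aligned_gZ hD hE hm hphi phi0 al) => //.
  by apply: contra s0 => /eqP h; rewrite e h mul0mx.
have [c3 c30 e3] := aligned_rk1 hD hE hphi phi0 al x0 y30.
have [c4 c40 e4] := aligned_rk1 hD hE hphi phi0 al x0 y40.
have [d ed] := h34.
have inj y y' : phi (x *m y) = phi (x *m y') -> y = y'.
  move=> e; apply: contraPeq e => yy'.
  apply/eqP; apply: (hphi _ _).1; last by rewrite -mulmxBr; exists x, (y - y').
  by rewrite -subr_eq0 -mulmxBr; apply: mulmx_cr_neq0; rewrite // subr_eq0.
case: hcard => [[e [en0 e1]]|E01]; last first.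
  (* All nonzero scalars of E are 1, so phi (x y3) = phi (x y4), and injectivity on L(x) gives y3 =
     y4. *)
  have one (z : 'M[E]_1) : z != 0 -> z = 1%:M.
    by case: (E01 z) => -> //; rewrite eqxx.
  have d1 : d = 1%:M.
    apply: one; apply: contra (al_g0 al y40) => /eqP h.
    by rewrite ed h mul0mx.
  case: npar; exists 1%:M; rewrite mul1mx; apply: inj.
  by rewrite e3 e4 (one _ c30) (one _ c40) ed d1 mul1mx.
have [e' [ee' e'e]] := mx11_inv hD en0.
pose w := e' *m y3 + y4; pose y0 := (1%:M - e') *m y3.
have eS : y0 + w = y3 + y4.
  by rewrite /y0 /w mulmxBl mul1mx addrA subrK.
have eT : y0 + (1%:M - e) *m w = (1%:M - e) *m y4.
  rewrite /y0 /w mulmxDr mulmxA addrA -mulmxDl [(_ - e) *m e']mulmxBl.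
  by rewrite mul1mx ee' addrA subrK subrr mul0mx add0r.
have e1' : 1%:M - e != 0 by rewrite subr_eq0 eq_sym.
have w0 : w != 0.
  apply/eqP => h; apply: npar; exists (- e').
  by rewrite mulNmx; apply/eqP; rewrite -addr_eq0 addrC -/w h.
have par3 y : rpar y3 y \/ rpar y4 y ->
    exists k, phi (x *m y) = f x *m k *m g y3.
  have [->|yn0] := eqVneq y 0; first by exists 0; rewrite !mulmx0 phi0 mul0mx.
  have [k k0 ->] := aligned_rk1 hD hE hphi phi0 al x0 yn0.
  have nz z (a : 'M_1) : y = a *m z -> a != 0.
    by move=> ey; apply: contra yn0 => /eqP h; rewrite ey h mul0mx.
  case=> -[a ea]; have a0 := nz _ _ ea.
    have [b eb] := aligned_gZ hD hE hm hphi phi0 al y30 a0.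
    by exists (k *m b); rewrite ea eb !mulmxA.
  have [b eb] := aligned_gZ hD hE hm hphi phi0 al y40 a0.
  by exists (k *m b *m d); rewrite ea eb ed !mulmxA.
have [k0 ek0] := par3 y0 (or_introl (ex_intro _ _ erefl)).
have [k1 ek1] := par3 _ (or_intror (ex_intro _ (1%:M - e) erefl)).
have [f' [g' al']] := eal (x *m y0).
have [b] := al_R al' w0 (x *m (1%:M - e)).
rewrite /recenter -mulmxA -mulmxDr eT ek1 ek0 -mulmxBl -mulmxBr => eb.
have [l el] : rpar (g y3) (g' w).
  apply: rpar_sym; [exact: hE | exact: al_g0 al _ y30 |].
  apply: rpar_eq eb => //.
  apply: contraTneq w0 => h; rewrite negbK.
  have : phi (x *m ((1%:M - e) *m y4)) = phi (x *m y0).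
    apply/eqP; rewrite ek1 ek0 -subr_eq0 -mulmxBl -mulmxBr h mul0mx //.
  rewrite -eT => /inj /eqP; rewrite -subr_eq0 addrC addKr => /eqP.
  by move=> /mulmx_cr_eq0 - /(_ hD) [/eqP h'|->]; first by rewrite h' in e1'.
have [b'] := al_R al' w0 x; rewrite /recenter -mulmxDr eS ek0 => /eqP.
rewrite subr_eq el mulmxA -mulmxDl => /eqP.
by apply: (aligned_rpar hD hE hphi phi0 al).
Qed.

End Everywhere.

(** * Images of spans of two vectors *)

Section Lineation.
Variables D E : unitRingType.
Hypotheses (hD : division_ring D) (hE : division_ring E).
Hypothesis hcard : (exists d : 'M[D]_1, d != 0 /\ d != 1%:M) \/
  (forall e : 'M[E]_1, e = 0 \/ e = 1%:M).
Variables m n p q : nat.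
Hypotheses (hm : (0 < m)%N) (hn : (0 < n)%N).
Implicit Types (x : 'cV[D]_m) (y : 'rV[D]_n) (u : 'cV[E]_p) (v : 'rV[E]_q).
Variables (phi : 'M[D]_(m, n) -> 'M[E]_(p, q)).
Hypotheses (hphi : rk1_preserver phi) (phi0 : phi 0 = 0).
Variables (f : 'cV[D]_m -> 'cV[E]_p) (g : 'rV[D]_n -> 'rV[E]_q).
Hypotheses (al : aligned phi f g) (eal : everywhere_aligned phi).

Lemma gpar_span y3 y4 (a b : 'M_1) : y3 != 0 -> y4 != 0 ->
  a *m y3 + b *m y4 != 0 ->
  rpar (g y3) (g y4) -> rpar (g y3) (g (a *m y3 + b *m y4)).
Proof.
move=> y30 y40 z0 h.
have gZ := aligned_gZ hD hE hm hphi phi0 al.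
have [a0|a0] := eqVneq a 0.
  rewrite a0 mul0mx add0r in z0 *; apply: rpar_trans h _; apply: gZ => //.
  by apply: contra z0 => /eqP ->; rewrite mul0mx.
have [b0|b0] := eqVneq b 0; first by rewrite b0 mul0mx addr0; apply: gZ.
have ay0 : a *m y3 != 0 by apply: mulmx_1r_neq0.
have by0 : b *m y4 != 0 by apply: mulmx_1r_neq0.
apply: rpar_trans (gZ _ _ y30 a0) _.
apply: (gpar_add hD hE hcard hm hphi phi0 al eal) => //.
apply: rpar_trans (rpar_trans h (gZ _ _ y40 b0)).
by apply: rpar_sym (gZ _ _ y30 a0) => //; apply: al_g0 al _ ay0.
Qed.

Section Span.
Variables (x1 x2 : 'cV[D]_m) (y1 y2 : 'rV[D]_n).
Hypotheses (x10 : x1 != 0) (x20 : x2 != 0) (y10 : y1 != 0) (y20 : y2 != 0).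
Hypotheses (nf : ~ cpar (f x1) (f x2)) (ng : ~ rpar (g y1) (g y2)).
Variables (k : nat) (N : 'M[E]_(k, p)).
Hypotheses (N1 : N *m f x1 = 0) (N2 : N *m f x2 = 0).

(** Membership in the span of f(x1) and f(x2) is tested by annihilators [N]. If N phi(A) were
    nonzero, phi(A) - phi(x1 y1) and phi(A) - phi(x2 y2) would have parallel rows, and phi(x1 y1) -
    phi(x2 y2) would have rank one. *)
Lemma phi_left_span : N *m phi (x1 *m y1 + x2 *m y2) = 0.
Proof.
set A := _ + _; have [s s0 es] := aligned_rk1 hD hE hphi phi0 al x10 y10.
have [t t0 et] := aligned_rk1 hD hE hphi phi0 al x20 y20.
have [c [w ew]] : rk1 (phi A - phi (x1 *m y1)).
  by apply: preserver_rk1 => //; rewrite /A addrC addKr; exists x2, y2.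
have [c' [w' ew']] : rk1 (phi A - phi (x2 *m y2)).
  by apply: preserver_rk1 => //; rewrite /A addrK; exists x1, y1.
have e1 : N *m phi A = N *m c *m w.
  by rewrite -mulmxA -ew mulmxBr es !mulmxA N1 !mul0mx subr0.
have e2 : N *m phi A = N *m c' *m w'.
  by rewrite -mulmxA -ew' mulmxBr et !mulmxA N2 !mul0mx subr0.
have [c0|c0] := eqVneq (N *m c') 0; first by rewrite e2 c0 mul0mx.
have [l el] := rpar_eq hE c0 (etrans (esym e2) e1).
have : rk1 (f x1 *m (s *m g y1) - (f x2 *m t) *m g y2).
  exists (c' *m l - c), w; rewrite mulmxBl -(mulmxA c') -el -ew -ew' es et.
  by rewrite opprB [RHS]addrC addrA subrK mulmxA.
case/(rk1_sub_par hE (al_f0 al x10) (al_g0 al y20)) => h.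
  case: nf; apply: cpar_trans h _; have [t' [tt' _]] := mx11_inv hE t0.
  by exists t'; rewrite -mulmxA tt' mulmx1.
case: ng; apply: (rpar_sym hE (al_g0 al y10)); apply: rpar_trans h _.
have [s' [_ ss']] := mx11_inv hE s0.
by exists s'; rewrite mulmxA ss' mul1mx.
Qed.

(** Up to scaling the vector is z = x1 + x2 c, and A = x1 y1 + x2 y2 differs from z y1 by rank at
    most one. As [N] kills phi(A), a nonzero N f(z) would put the row of the difference of images on
    the line of g(y1), and phi(A) into R(g(y1)). *)
Lemma f_span (a b : 'M_1) : x1 *m a + x2 *m b != 0 ->
  N *m f (x1 *m a + x2 *m b) = 0.
Proof.
have fZ z (c : 'M_1) : z != 0 -> c != 0 -> N *m f z = 0 -> N *m f (z *m c) = 0.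
  move=> z0 c0 h; have [d ->] := aligned_fZ hD hE hn hphi phi0 al z0 c0.
  by rewrite mulmxA h mul0mx.
have [->|a0] := eqVneq a 0.
  rewrite mulmx0 add0r => z0; apply: fZ => //.
  by apply: contra z0 => /eqP ->; rewrite mulmx0.
move=> z0; have [a' [aa' a'a]] := mx11_inv hD a0.
pose z := x1 + x2 *m (b *m a').
have ez : x1 *m a + x2 *m b = z *m a.
  by rewrite /z mulmxDl -!mulmxA a'a mulmx1.
have zn0 : z != 0 by apply: contra z0 => /eqP h; rewrite ez h mul0mx.
rewrite ez; apply: fZ => //.
set A := x1 *m y1 + x2 *m y2.
have [s s0 es] := aligned_rk1 hD hE hphi phi0 al zn0 y10.
have [c [w ew]] : rk1 (phi A - phi (z *m y1)).
  apply: preserver_rk1 => //; exists x2, (y2 - b *m a' *m y1).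
  by rewrite /A /z mulmxDl mulmxBr opprD addrACA subrr add0r !mulmxA.
have [//|Nf0] := eqVneq (N *m f z) 0.
have e : N *m f z *m s *m g y1 = - (N *m c) *m w.
  rewrite mulNmx -(mulmxA N c) -ew mulmxBr phi_left_span es !mulmxA.
  by rewrite sub0r opprK.
have Ns : N *m f z *m s != 0 by apply: mulmx_c1_neq0.
have [l el] := rpar_sym hE (al_g0 al y10) (rpar_eq hE Ns e).
case: (aligned_rank2 hD hE hcard hm hn hphi phi0 al x10 x20 y10 y20 nf ng).
exists (f z *m s + c *m l), (g y1).
by rewrite mulmxDl -es -(mulmxA c) -el -ew [RHS]addrC subrK.
Qed.

End Span.
End Lineation.

Section LineationTransposed.
Variables D E : unitRingType.
Hypotheses (hD : division_ring D) (hE : division_ring E).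
Hypothesis hcard : (exists d : 'M[D]_1, d != 0 /\ d != 1%:M) \/
  (forall e : 'M[E]_1, e = 0 \/ e = 1%:M).
Variables m n p q : nat.
Hypotheses (hm : (0 < m)%N) (hn : (0 < n)%N).
Implicit Types (x : 'cV[D]_m) (y : 'rV[D]_n) (u : 'cV[E]_p) (v : 'rV[E]_q).
Variables (phi : 'M[D]_(m, n) -> 'M[E]_(p, q)).
Hypotheses (hphi : rk1_preserver phi) (phi0 : phi 0 = 0).
Variables (f : 'cV[D]_m -> 'cV[E]_p) (g : 'rV[D]_n -> 'rV[E]_q).
Hypotheses (al : aligned phi f g) (eal : everywhere_aligned phi).

Let hphi' := transposed_preserver hphi.
Let phi0' : transposed phi 0 = 0.
Proof. by rewrite /transposed trmx0 phi0 trmx0. Qed.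
Let al' := transposed_aligned al.
Let eal' := transposed_everywhere_aligned eal.
Let hD' : division_ring D^c := hD.
Let hE' : division_ring E^c := hE.

Lemma fpar_span x3 x4 (a b : 'M_1) : x3 != 0 -> x4 != 0 ->
  x3 *m a + x4 *m b != 0 ->
  cpar (f x3) (f x4) -> cpar (f x3) (f (x3 *m a + x4 *m b)).
Proof.
move=> x30 x40 z0 h; apply: cpar_tr.
have := @gpar_span D^c E^c hD' hE' hcard n m q p hn _ hphi' phi0' _ _ al' eal'
  x3^T x4^T a^T b^T.
rewrite !trmx_neq0 !mulmx_trc -linearD trmx_neq0 !trmxK.
by apply=> //; apply: tr_cpar.
Qed.

Section Span.
Variables (x1 x2 : 'cV[D]_m) (y1 y2 : 'rV[D]_n).
Hypotheses (x10 : x1 != 0) (x20 : x2 != 0) (y10 : y1 != 0) (y20 : y2 != 0).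
Hypotheses (nf : ~ cpar (f x1) (f x2)) (ng : ~ rpar (g y1) (g y2)).
Variables (k : nat) (N : 'M[E]_(q, k)).
Hypotheses (N1 : g y1 *m N = 0) (N2 : g y2 *m N = 0).

Lemma phi_right_span : phi (x1 *m y1 + x2 *m y2) *m N = 0.
Proof.
apply: trmx_inj; rewrite -[LHS]mulmx_trc trmx0.
have := @phi_left_span D^c E^c hD' hE' n m q p _ hphi' phi0' _ _ al'
  y1^T y2^T x1^T x2^T _ _ _ _ _ _ k N^T.
rewrite !trmx_neq0 !mulmx_trc -linearD /transposed !trmxK.
apply=> //; rewrite ?N1 ?N2 ?trmx0 //.
- by move=> /rpar_tr.
- by move=> /cpar_tr.
Qed.

Lemma g_span (a b : 'M_1) : a *m y1 + b *m y2 != 0 ->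
  g (a *m y1 + b *m y2) *m N = 0.
Proof.
move=> z0; apply: trmx_inj; rewrite -[LHS]mulmx_trc trmx0.
have := @f_span D^c E^c hD' hE' hcard n m q p hn hm _ hphi' phi0' _ _ al'
  y1^T y2^T x1^T x2^T _ _ _ _ _ _ k N^T _ _ a^T b^T.
rewrite !trmx_neq0 !mulmx_trc -linearD trmx_neq0 !trmxK.
apply=> //; rewrite ?N1 ?N2 ?trmx0 //.
- by move=> /rpar_tr.
- by move=> /cpar_tr.
Qed.

End Span.
End LineationTransposed.

(** * Two by two matrices *)

Lemma rmorphism_of (D E : nzRingType) (t : D -> E) :
  (forall a b, t (a + b) = t a + t b) -> (forall a b, t (a * b) = t a * t b) ->
  t 1 = 1 -> exists r : {rmorphism D -> E}, r =1 t.
Proof.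
move=> tD tM t1.
have t0 : t 0 = 0 by apply: (addrI (t 0)); rewrite -tD !addr0.
have tB : {morph t : a b / a - b}.
  by move=> a b; apply: (addIr (t b)); rewrite -tD !subrK.
have tmul : GRing.monoid_morphism t by split.
pose r := HB.pack_for {rmorphism D -> E} t
  (GRing.isZmodMorphism.Build D E t tB)
  (GRing.isMonoidMorphism.Build D E t tmul).
by exists r.
Qed.

Lemma I2P (i i' l : 'I_2) : i != i' -> l = i \/ l = i'.
Proof.
case: i i' l => [[|[|?]] ?] [[|[|?]] ?] [[|[|?]] ?] //= _;
  by [left; apply/val_inj | right; apply/val_inj].
Qed.

Lemma sum_I2 (V : nmodType) (i i' : 'I_2) (F : 'I_2 -> V) :
  i != i' -> \sum_k F k = F i + F i'.
Proof.
move=> ii'; rewrite (bigD1 i) //= (bigD1 i') /=; last by rewrite eq_sym.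
rewrite big1 ?addr0 // => k /andP[ki ki'].
by case: (I2P k ii') => e; rewrite e eqxx in ki ki'.
Qed.

Lemma scalar11_inj (R : nzRingType) : injective (fun a : R => a%:M : 'M_1).
Proof. by move=> a b /matrixP/(_ 0 0); rewrite !mxE. Qed.

Lemma scalar11_eq0 (R : nzRingType) (a : R) : (a%:M == 0 :> 'M_1) = (a == 0).
Proof.
by apply/eqP/eqP => [h|->]; [apply: scalar11_inj; rewrite h|]; rewrite raddf0.
Qed.

(** With i' and j' the other indices, the entries at (i, j), (i, j'), (i', j), (i', j') are a, b, c,
    d; the position is a parameter so that one argument serves all four entries. *)
Definition mx2 (R : Type) (i j : 'I_2) (a b c d : R) : 'M[R]_2 :=
  \matrix_(k, l) if k == i then if l == j then a else b
                 else if l == j then c else d.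

Section Two.
Variables D E : unitRingType.
Hypotheses (hD : division_ring D) (hE : division_ring E).
Hypothesis hcard : (exists d : 'M[D]_1, d != 0 /\ d != 1%:M) \/
  (forall e : 'M[E]_1, e = 0 \/ e = 1%:M).
Hypothesis hsurj : forall (t : {rmorphism D -> E}) (e : E), exists d, t d = e.
Variables (phi : 'M[D]_2 -> 'M[E]_2).
Variables (f : 'cV[D]_2 -> 'cV[E]_2) (g : 'rV[D]_2 -> 'rV[E]_2).
Hypotheses (hphi : rk1_preserver phi) (phi0 : phi 0 = 0).
Hypothesis hfg : forall (x : 'cV_2) (y : 'rV_2),
  x != 0 -> y != 0 -> forall a : 'M_1,
  exists c : 'M_1, phi (x *m a *m y) = f x *m c *m g y.
(** A choice of coordinates in the target achieves this normalisation. [f_full] and [g_full] are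
    what separation provides there: a vector off both coordinate lines stays off them. *)
Hypothesis f_delta : forall j : 'I_2, f (delta_mx j 0) = delta_mx j 0.
Hypothesis g_delta : forall i : 'I_2, g (delta_mx 0 i) = delta_mx 0 i.
Hypothesis f_full : forall x : 'cV_2,
  (forall j, x j 0 != 0) -> forall j, f x j 0 != 0.
Hypothesis g_full : forall y : 'rV_2,
  (forall i, y 0 i != 0) -> forall i, g y 0 i != 0.
Hypothesis phi_inv : forall X, invertible_mx X -> invertible_mx (phi X).

Lemma row2_kernel (w : 'rV[E]_2) : exists2 k : 'cV[E]_2, k != 0 & w *m k = 0.
Proof.
have [->|w0] := eqVneq w 0.
  have [k k0] := @ex_cV_neq0 E 2 isT; exists k => //.
  by rewrite mul0mx.
have [S [T [ST TS]] wS] := @row_complete E hE 1 w w0.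
exists (S *m col_mx 0 1%:M).
  apply/eqP => /(congr1 (mulmx T)); rewrite mulmxA TS mul1mx mulmx0 => h.
  have := congr1 (@dsubmx E 1 1 1) h; rewrite col_mxKd linear0 => /eqP.
  by apply/negP; apply: mx11_neq0.
by rewrite mulmxA wS mul_row_col mulmx0 mul0mx addr0.
Qed.

Lemma invertible_triangular (i i' j j' : 'I_2) (Z : 'M[D]_2) :
  i != i' -> j != j' -> Z i' j = 0 -> Z i j != 0 -> Z i' j' != 0 ->
  invertible_mx Z.
Proof.
move=> ii' jj' z0 /hD z1 /hD z2.
have : left_independent Z.
  move=> u uZ; have ui : u 0 i = 0.
    have /matrixP/(_ 0 j) := uZ; rewrite !mxE (sum_I2 _ ii') z0 mulr0 addr0.
    by move/(congr1 (fun t => t * (Z i j)^-1)); rewrite mulrK // mul0r.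
  have ui' : u 0 i' = 0.
    have /matrixP/(_ 0 j') := uZ; rewrite !mxE (sum_I2 _ ii') ui mul0r add0r.
    by move/(congr1 (fun t => t * (Z i' j')^-1)); rewrite mulrK // mul0r.
  apply/matrixP=> k l; rewrite !mxE (ord1 k).
  by case: (I2P l ii') => ->.
by case/(left_independent_complete hD) => _ [S hS ->]; rewrite pid_mx_1 mul1mx.
Qed.

Lemma ex_inverse_map : exists Phi : 'M[D]_2 -> 'M[E]_2,
  forall Z, invertible_mx Z -> exists X,
    (Z *m X = 1%:M /\ X *m Z = 1%:M) /\
    (phi X *m Phi Z = 1%:M /\ Phi Z *m phi X = 1%:M).
Proof.
suff : forall Z, exists C, invertible_mx Z -> exists X,
    (Z *m X = 1%:M /\ X *m Z = 1%:M) /\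
    (phi X *m C = 1%:M /\ C *m phi X = 1%:M).
  by move/(functional_choice _).
move=> Z; have [[X [ZX XZ]]|nZ] := classic (invertible_mx Z); last by exists 0.
have [C hC] : invertible_mx (phi X) by apply: phi_inv; exists Z.
by exists C => _; exists X.
Qed.

(** * Conjugation by inversion *)

Section InverseMap.
Variable Phi : 'M[D]_2 -> 'M[E]_2.
Hypothesis hPhi : forall Z, invertible_mx Z -> exists X,
    (Z *m X = 1%:M /\ X *m Z = 1%:M) /\
    (phi X *m Phi Z = 1%:M /\ Phi Z *m phi X = 1%:M).

(* [X - x d' y], with [X] the inverse of [Z], kills [Z x], so it has rank one;
   applying [phi] gives a singular matrix again, whose kernel yields the
   claim. *)
Lemma inverse_map_eval Z (x : 'cV[D]_2) (y : 'rV[D]_2) (d' : 'M[D]_1)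
    (c : 'M[E]_1) :
  invertible_mx Z -> y *m Z *m x != 0 -> d' *m (y *m Z *m x) = 1%:M ->
  phi (x *m d' *m y) = f x *m c *m g y ->
  (g y *m Phi Z *m f x) *m c = 1%:M.
Proof.
move=> Zinv d0 d'd ec; have [X [[ZX XZ] [XP PX]]] := hPhi Zinv.
have x0 : x != 0 by apply: contra d0 => /eqP ->; rewrite mulmx0.
have Zx0 : Z *m x != 0.
  by apply: contra d0 => /eqP h; rewrite -mulmxA h mulmx0.
have X1 : rk1 (X - x *m d' *m y).
  case: (invertible_or_rk1 hD (X - x *m d' *m y)) => // -[W [_ WX]].
  case/eqP: Zx0; rewrite -[LHS]mul1mx -WX -mulmxA mulmxBl.
  by rewrite mulmxA XZ mul1mx -!mulmxA (mulmxA y) d'd mulmx1 subrr mulmx0.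
have [u [w ew]] := preserver_rk1 hphi X1; have [k k0 wk] := row2_kernel w.
have eX : phi X *m k = f x *m c *m (g y *m k).
  by apply/eqP; rewrite -subr_eq0 mulmxA -ec -mulmxBl ew -mulmxA wk mulmx0.
have ek : k = Phi Z *m f x *m c *m (g y *m k).
  by rewrite -!mulmxA (mulmxA (f x)) -eX mulmxA PX mul1mx.
have gk0 : g y *m k != 0.
  by apply: contra k0 => /eqP h; rewrite ek h mulmx0.
have [l [kl _]] := mx11_inv hE gk0.
have : g y *m k = g y *m Phi Z *m f x *m c *m (g y *m k).
  by rewrite {1}ek !mulmxA.
by move/(congr1 (mulmx^~ l)); rewrite -[in RHS]mulmxA kl mulmx1.
Qed.

(** By [inverse_map_eval] the value is inverse to the scalar [c] of phi (x d' y) = f(x) c g(y), and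
    Z enters this only through d', the inverse of y Z x. *)
Lemma inverse_map_dep Z Z' (x : 'cV[D]_2) (y : 'rV[D]_2) :
  invertible_mx Z -> invertible_mx Z' -> y *m Z *m x != 0 ->
  y *m Z *m x = y *m Z' *m x ->
  g y *m Phi Z *m f x = g y *m Phi Z' *m f x /\ g y *m Phi Z *m f x != 0.
Proof.
move=> Zi Z'i d0 e; have [d' [_ d'd]] := mx11_inv hD d0.
have x0 : x != 0 by apply: contra d0 => /eqP ->; rewrite mulmx0.
have y0 : y != 0 by apply: contra d0 => /eqP ->; rewrite !mul0mx.
have [c ec] := hfg x0 y0 d'.
have h1 := inverse_map_eval Zi d0 d'd ec; rewrite e in d0 d'd.
have h2 := inverse_map_eval Z'i d0 d'd ec.
have c0 : c != 0.
  by apply: contra (mx11_neq0 E) => /eqP h; rewrite -h1 h mulmx0.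
have [l [cl _]] := mx11_inv hE c0; split.
  by rewrite -[LHS]mulmx1 -[RHS]mulmx1 -cl !mulmxA h1 h2.
by apply: contra (mx11_neq0 E) => /eqP h; rewrite -h1 h mul0mx.
Qed.

Lemma inverse_map_row Z Z' i (x : 'cV[D]_2) :
  invertible_mx Z -> invertible_mx Z' -> \sum_k Z i k * x k 0 != 0 ->
  \sum_k Z i k * x k 0 = \sum_k Z' i k * x k 0 ->
  \sum_k Phi Z i k * f x k 0 = \sum_k Phi Z' i k * f x k 0.
Proof.
move=> Zi Z'i d0 e.
have ev (R : nzRingType) (W : 'M[R]_2) (z : 'cV[R]_2) :
    delta_mx 0 i *m W *m z = (\sum_k W i k * z k 0)%:M.
  rewrite -rowE [LHS]mx11_scalar mxE; congr (_%:M).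
  by apply: eq_bigr => k _; rewrite mxE.
have [||h _] := @inverse_map_dep Z Z' x (delta_mx 0 i) Zi Z'i.
- by rewrite ev scalar11_eq0.
- by rewrite !ev e.
by move: h; rewrite g_delta !ev => /scalar11_inj.
Qed.

Lemma inverse_map_col Z Z' j (y : 'rV[D]_2) :
  invertible_mx Z -> invertible_mx Z' -> \sum_k y 0 k * Z k j != 0 ->
  \sum_k y 0 k * Z k j = \sum_k y 0 k * Z' k j ->
  \sum_k g y 0 k * Phi Z k j = \sum_k g y 0 k * Phi Z' k j.
Proof.
move=> Zi Z'i d0 e.
have ev (R : nzRingType) (W : 'M[R]_2) (z : 'rV[R]_2) :
    z *m W *m delta_mx j 0 = (\sum_k z 0 k * W k j)%:M.
  by rewrite -colE [LHS]mx11_scalar !mxE.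
have [||h _] := @inverse_map_dep Z Z' (delta_mx j 0) y Zi Z'i.
- by rewrite ev scalar11_eq0.
- by rewrite !ev e.
by move: h; rewrite f_delta !ev => /scalar11_inj.
Qed.

Lemma inverse_map_entry_neq0 Z Z' i j :
  invertible_mx Z -> invertible_mx Z' -> Z i j != 0 -> Z i j = Z' i j ->
  Phi Z i j = Phi Z' i j /\ Phi Z i j != 0.
Proof.
move=> Zi Z'i d0 e.
have ev (R : nzRingType) (W : 'M[R]_2) :
    (delta_mx 0 i : 'rV_2) *m W *m (delta_mx j 0 : 'cV_2) = (W i j)%:M.
  by rewrite -rowE -colE [LHS]mx11_scalar !mxE.
have [||h1 h2] := @inverse_map_dep Z Z' (delta_mx j 0) (delta_mx 0 i) Zi Z'i.
- by rewrite ev scalar11_eq0.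
- by rewrite !ev e.
move: h1 h2; rewrite f_delta g_delta !ev scalar11_eq0 => h1 h2; split=> //.
exact: scalar11_inj h1.
Qed.

Lemma invertible_row_neq0 (Z : 'M[D]_2) i j j' :
  invertible_mx Z -> j != j' -> Z i j = 0 -> Z i j' != 0.
Proof.
move=> [X [/matrixP/(_ i i) ZX _]] jj' z0; apply/eqP => z1.
move: ZX; rewrite !mxE (sum_I2 _ jj') z0 z1 !mul0r addr0 eqxx => /esym/eqP.
by rewrite oner_eq0.
Qed.

Lemma invertible_col_neq0 (Z : 'M[D]_2) i i' j :
  invertible_mx Z -> i != i' -> Z i j = 0 -> Z i' j != 0.
Proof.
move=> [X [_ /matrixP/(_ j j) XZ]] ii' z0; apply/eqP => z1.
move: XZ; rewrite !mxE (sum_I2 _ ii') z0 z1 !mulr0 addr0 eqxx => /esym/eqP.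
by rewrite oner_eq0.
Qed.

(** A zero entry escapes [inverse_map_dep]. Taking x with both coordinates 1 mixes it with its
    nonzero neighbour in the row, whose image is already controlled, and the coordinate of f(x) can
    be cancelled. *)
Lemma inverse_map_row0 Z Z' i j j' :
  invertible_mx Z -> invertible_mx Z' -> j != j' ->
  Z i j = 0 -> Z' i j = 0 -> Z i j' = Z' i j' -> Phi Z i j = Phi Z' i j.
Proof.
move=> Zi Z'i jj' z0 z0' e; have z1 := invertible_row_neq0 Zi jj' z0.
have [h _] := inverse_map_entry_neq0 Zi Z'i z1 e.
pose x : 'cV[D]_2 := const_mx 1.
have fx k : f x k 0 != 0 by apply: f_full => l; rewrite mxE oner_neq0.
have sx (W : 'M_2) : W i j = 0 -> \sum_k W i k * x k 0 = W i j'.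
  by move=> W0; rewrite (sum_I2 _ jj') W0 mul0r add0r mxE mulr1.
have := @inverse_map_row Z Z' i x Zi Z'i; rewrite !sx // => /(_ z1 e).
rewrite !(sum_I2 _ jj') h => /addIr; apply: mulIr; exact: hE.
Qed.

Lemma inverse_map_col0 Z Z' i i' j :
  invertible_mx Z -> invertible_mx Z' -> i != i' ->
  Z i j = 0 -> Z' i j = 0 -> Z i' j = Z' i' j -> Phi Z i j = Phi Z' i j.
Proof.
move=> Zi Z'i ii' z0 z0' e; have z1 := invertible_col_neq0 Zi ii' z0.
have [h _] := inverse_map_entry_neq0 Zi Z'i z1 e.
pose y : 'rV[D]_2 := const_mx 1.
have gy k : g y 0 k != 0 by apply: g_full => l; rewrite mxE oner_neq0.
have sy (W : 'M_2) : W i j = 0 -> \sum_k y 0 k * W k j = W i' j.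
  by move=> W0; rewrite (sum_I2 _ ii') W0 mulr0 add0r mxE mul1r.
have := @inverse_map_col Z Z' j y Zi Z'i; rewrite !sy // => /(_ z1 e).
rewrite !(sum_I2 _ ii') h => /addIr; apply: mulrI; exact: hE.
Qed.

Section Indices.
Variables i i' j j' : 'I_2.
Hypotheses (ii' : i != i') (jj' : j != j').

Lemma mx2E (R : Type) (a b c d : R) :
  ((mx2 i j a b c d i j = a) * (mx2 i j a b c d i j' = b)) *
  ((mx2 i j a b c d i' j = c) * (mx2 i j a b c d i' j' = d)).
Proof.
by rewrite !mxE !eqxx ![_ == i]eq_sym ![_ == j]eq_sym (negPf ii') (negPf jj').
Qed.

(** For a zero entry, [W] agrees with Z on row [i] and with Z' on column [j], and so joins the row
    argument to the column argument. *)
Lemma inverse_map_entry Z Z' : invertible_mx Z -> invertible_mx Z' ->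
  Z i j = Z' i j -> Phi Z i j = Phi Z' i j.
Proof.
move=> Zi Z'i e; have [z0|z0] := eqVneq (Z i j) 0; last first.
  by case: (inverse_map_entry_neq0 Zi Z'i z0 e).
have z0' : Z' i j = 0 by rewrite -e.
pose W := mx2 i j 0 (Z i j') (Z' i' j) 0.
have Wi : invertible_mx W.
  apply: (invertible_triangular ii' (j := j') (j' := j)); rewrite ?mx2E //.
  - by rewrite eq_sym.
  - exact: invertible_row_neq0 Zi jj' z0.
  - exact: invertible_col_neq0 Z'i ii' z0'.
transitivity (Phi W i j).
  by apply: (inverse_map_row0 Zi Wi jj'); rewrite ?mx2E.
by apply: (inverse_map_col0 Wi Z'i ii'); rewrite ?mx2E.
Qed.

Lemma invertible_diag2 (a b d : D) : a != 0 -> d != 0 ->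
  invertible_mx (mx2 i j a b 0 d).
Proof.
by move=> a0 d0; apply: (invertible_triangular ii' jj'); rewrite ?mx2E.
Qed.

Lemma invertible_anti2 (a b c : D) : b != 0 -> c != 0 ->
  invertible_mx (mx2 i j a b c 0).
Proof.
move=> b0 c0; apply: (invertible_triangular ii' (j := j') (j' := j));
  by rewrite ?mx2E // eq_sym.
Qed.

End Indices.

(** * The Pexider equation for one entry *)

Section Additive.
Variables i i' j j' : 'I_2.
Hypotheses (ii' : i != i') (jj' : j != j').
(** The entry of [Phi Z] as a function of the corresponding entry of Z; the remaining entries are
    fixed so that the matrix is invertible for every argument. *)
Let u (a : D) : E := Phi (mx2 i j a 1 1 0) i j.
Let v (b : D) : E := Phi (mx2 i j 1 b 0 1) i j'.

Let uE Z : invertible_mx Z -> Phi Z i j = u (Z i j).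
Proof.
move=> Zi; apply: (inverse_map_entry ii' jj') => //.
  by apply: (invertible_anti2 ii' jj'); rewrite ?oner_neq0.
by rewrite (mx2E ii' jj').
Qed.

Let vE Z : invertible_mx Z -> Phi Z i j' = v (Z i j').
Proof.
have j'j : j' != j by rewrite eq_sym.
move=> Zi; apply: (inverse_map_entry ii' j'j) => //.
  by apply: (invertible_diag2 ii' jj'); rewrite ?oner_neq0.
by rewrite (mx2E ii' jj').
Qed.

Let row_ex (a b : D) : a != 0 \/ b != 0 ->
  exists Z, [/\ invertible_mx Z, Z i j = a & Z i j' = b].
Proof.
have [->|a0] := eqVneq a 0 => [[//|b0]|_].
  exists (mx2 i j 0 b 1 0); rewrite !(mx2E ii' jj'); split=> //.
  by apply: (invertible_anti2 ii' jj'); rewrite ?oner_neq0.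
exists (mx2 i j a b 0 1); rewrite !(mx2E ii' jj'); split=> //.
by apply: (invertible_diag2 ii' jj'); rewrite ?oner_neq0.
Qed.

(* [k] is the ratio of the coordinates of [f x], where x = e_j + e_j' c. *)
Let pexider (c : D) : c != 0 -> exists2 k : E, k != 0 &
  forall a b a' b', a + b * c != 0 -> a + b * c = a' + b' * c ->
    u a + v b * k = u a' + v b' * k.
Proof.
move=> c0; pose x : 'cV[D]_2 := \col_k if k == j then 1 else c.
have fx k : f x k 0 != 0.
  by apply: f_full => l; rewrite mxE; case: ifP; rewrite ?oner_neq0.
have /hE fjU := fx j; have /hE fj'U := fx j'.
exists (f x j' 0 / f x j 0).
  by apply/eqP => h; move: (fx j'); rewrite -[f x j' 0](divrK fjU) h mul0r eqxx.
move=> a b a' b' s0 e.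
have nz r t : r + t * c != 0 -> r != 0 \/ t != 0.
  move=> h; have [r0|r0] := eqVneq r 0; [right|by left].
  by apply: contra h => /eqP ->; rewrite r0 mul0r addr0.
have [Z [Zi Zj Zj']] := row_ex (nz _ _ s0).
rewrite e in s0; have [Z' [Z'i Z'j Z'j']] := row_ex (nz _ _ s0).
have sx W : \sum_k W i k * x k 0 = W i j + W i j' * c.
  by rewrite (sum_I2 _ jj') !mxE eqxx eq_sym (negPf jj') mulr1.
have := @inverse_map_row Z Z' i x Zi Z'i.
rewrite !sx Zj Zj' Z'j Z'j' e => /(_ s0 erefl).
rewrite !(sum_I2 _ jj') !uE // !vE // Zj Zj' Z'j Z'j' => h.
by apply: (mulIr fjU); rewrite !mulrDl -!mulrA mulVr // !mulr1.
Qed.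

Let T a := u a - u 0.
Let T' b := v b - v 0.

Let T'_mul c : c != 0 -> exists2 k : E, k != 0 & forall b, T' b * k = T (b * c).
Proof.
move=> c0; have [k k0 hk] := pexider c0; exists k => // b.
have [->|b0] := eqVneq b 0; first by rewrite mul0r /T /T' !subrr mul0r.
have bc0 : b * c != 0.
  by apply/eqP => h; case/eqP: b0; apply: (mulIr (hD c0)); rewrite h mul0r.
have := hk 0 b (b * c) 0; rewrite mul0r addr0 add0r => /(_ bc0 erefl) h.
rewrite /T /T' mulrBl; apply: (addrI (u 0)).
by rewrite addrA h addrK [RHS]addrC subrK.
Qed.

(** The Pexider equation with c = 1 is applied to the pairs (a, s - a) and (s, 0); it requires their
    common sum s to be nonzero. *)
Let T_subr s a : s != 0 -> T (s - a) = T s - T a.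
Proof.
move=> s0; have [k k0 hk] := pexider (oner_neq0 D).
have h b : T' b * k = T b.
  have [->|b0] := eqVneq b 0; first by rewrite /T /T' !subrr mul0r.
  have := hk 0 b b 0; rewrite mul0r addr0 add0r mulr1 => /(_ b0 erefl) h.
  rewrite /T /T' mulrBl; apply: (addrI (u 0)).
  by rewrite addrA h addrK [RHS]addrC subrK.
rewrite -h /T' mulrBl; have := hk a (s - a) s 0.
rewrite !mulr1 [a + _]addrC subrK addr0 => /(_ s0 erefl) e.
have -> : T s - T a = u s - u a by rewrite /T opprB addrA subrK.
by apply: (addrI (u a)); rewrite addrA e addrK [RHS]addrC subrK.
Qed.

Let T0 : T 0 = 0. Proof. exact: subrr. Qed.

Let T_opp a : T (- a) = - T a.
Proof.
have [->|a0] := eqVneq a 0; first by rewrite oppr0 T0 oppr0.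
(* With d and d - a both nonzero, [T_subr] applies to (d - a) - (- a) = d and again to d - a. *)
have [[d [d0 da]]|h] := classic (exists d : D, d != 0 /\ d != a).
  have := @T_subr (d - a) (- a); rewrite opprK subrK T_subr // subr_eq0.
  by move=> /(_ da) h; rewrite -[LHS](subKr (T d - T a)) -h addrAC subrr sub0r.
(* Here D has only two elements, hence so has E by [hcard], and signs disappear. *)
have {}h d : d != 0 -> d = a.
  by move=> d0; apply/eqP/negPn/negP => da; apply: h; exists d.
rewrite (h (- a)) ?oppr_eq0 //; apply/eqP; rewrite -addr_eq0; apply/eqP.
case: hcard => [[d [d0 d1]]|E01].
  case/eqP: d1; rewrite [d]mx11_scalar in d0 *; rewrite scalar11_eq0 in d0.
  by rewrite (h _ d0) (h 1) ?oner_neq0.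
suff e11 : 1 + 1 = 0 :> E by rewrite -[T a]mul1r -mulrDl e11 mul0r.
have [h'|h'] := E01 (1 + 1)%:M; first by apply: scalar11_inj; rewrite h' raddf0.
by have /eqP := scalar11_inj h'; rewrite -subr_eq0 addrK oner_eq0.
Qed.

Let T_add a b : T (a + b) = T a + T b.
Proof.
have [s0|s0] := eqVneq (a + b) 0.
  by move/eqP: s0; rewrite addr_eq0 => /eqP ->; rewrite addNr T0 T_opp addNr.
have := T_subr a s0; rewrite [_ - a]addrC addKr => ->.
by rewrite [RHS]addrC subrK.
Qed.

(** Otherwise row [i] of [Phi] is constant, and Z, Z' differing only in that row have the same
    image. Then phi agrees at their inverses X, X', although X - X' = X (Z' - Z) X' has rank one. *)
Let T1_neq0 : T 1 != 0.
Proof.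
apply/eqP => T1; have T_eq0 c : T c = 0.
  have [k k0 hk] := T'_mul (oner_neq0 D).
  have T'1 : T' 1 = 0.
    by apply: (mulIr (hE k0)); rewrite hk mulr1 T1 mul0r.
  have [->|c0] := eqVneq c 0; first exact: T0.
  by have [l l0 hl] := T'_mul c0; rewrite -[c]mul1r -hl T'1 mul0r.
have T'_eq0 c : T' c = 0.
  have [k k0 hk] := T'_mul (oner_neq0 D).
  by apply: (mulIr (hE k0)); rewrite hk T_eq0 mul0r.
have uc a : u a = u 0 by apply/eqP; rewrite -subr_eq0 -/(T a) T_eq0.
have vc a : v a = v 0 by apply/eqP; rewrite -subr_eq0 -/(T' a) T'_eq0.
have [i'i j'j] : i' != i /\ j' != j.
  by rewrite (eq_sym i') (eq_sym j').
pose Z := mx2 i j (1 : D) 0 1 1; pose Z' := mx2 i j (0 : D) 1 1 1.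
have Zi : invertible_mx Z.
  by apply: (invertible_triangular i'i j'j); rewrite !(mx2E ii' jj') ?oner_neq0.
have Z'i : invertible_mx Z'.
  by apply: (invertible_triangular i'i jj'); rewrite !(mx2E ii' jj') ?oner_neq0.
have ePhi : Phi Z = Phi Z'.
  apply/matrixP=> k l; case: (I2P k ii') => ->; case: (I2P l jj') => ->.
  - by rewrite !uE // uc [RHS]uc.
  - by rewrite !vE // vc [RHS]vc.
  - by apply: (inverse_map_entry i'i jj'); rewrite // !(mx2E ii' jj').
  - by apply: (inverse_map_entry i'i j'j); rewrite // !(mx2E ii' jj').
have [X [[ZX XZ] [P1 P2]]] := hPhi Zi.
have [X' [[ZX' XZ'] [P1' P2']]] := hPhi Z'i.
have eX : phi X = phi X'.
  by rewrite -[LHS]mulmx1 -P2' -ePhi mulmxA P1 mul1mx.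
have XX' : X != X'.
  apply/eqP => e; have : Z = Z' by rewrite -[Z]mulmx1 -XZ' -e mulmxA ZX mul1mx.
  move/matrixP/(_ i j); rewrite !(mx2E ii' jj') => /eqP; by rewrite oner_eq0.
have : rk1 (X - X').
  have -> : X - X' = X *m (Z' - Z) *m X'.
    by rewrite mulmxBr mulmxBl XZ mul1mx -mulmxA ZX' mulmx1.
  apply: rk1_mulr; apply: rk1_mull; exists (delta_mx i 0), (row i (Z' - Z)).
  apply/matrixP=> k l; rewrite [RHS]mxE big_ord1 !mxE.
  case: (I2P k ii') => ->; first by rewrite !eqxx mul1r.
  by rewrite (negPf i'i) subrr mul0r.
by case/(hphi XX'); rewrite eX eqxx.
Qed.

Lemma inverse_map_zero_surj :
  (forall Z, invertible_mx Z -> Z i j = 0 -> Phi Z i j = 0) /\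
  (forall e, exists2 a, forall Z, invertible_mx Z -> Z i j = a -> Phi Z i j = e
     & e != 0 -> a != 0).
Proof.
have T1U := hE T1_neq0; pose t a := (T 1)^-1 * T a.
(* T(a b) = T'(a) k, T(b) = T'(1) k, T(a) = T'(a) l and T(1) = T'(1) l; eliminating k, l and T'
   gives T(a b) = T(a) T(1)^-1 T(b). *)
have tM a b : t (a * b) = t a * t b.
  rewrite /t; have [->|b0] := eqVneq b 0; first by rewrite mulr0 T0 !mulr0.
  have [k k0 hk] := T'_mul b0; have [l l0 hl] := T'_mul (oner_neq0 D).
  have e1 : T a = T' a * l by rewrite hl mulr1.
  have e2 : T 1 = T' 1 * l by rewrite hl mulr1.
  have e3 : T b = T' 1 * k by rewrite hk mul1r.
  have T'1U : T' 1 \is a GRing.unit.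
    by apply: hE; apply: contra T1_neq0 => /eqP h; rewrite e2 h mul0r.
  rewrite -mulrA; congr (_ * _).
  have -> : (T 1)^-1 = l^-1 * (T' 1)^-1 by rewrite e2 invrM // hE.
  by rewrite -hk e1 e3 !mulrA mulrK ?hE // mulrVK.
have tD a b : t (a + b) = t a + t b by rewrite /t T_add mulrDr.
have [r hr] := rmorphism_of tD tM (mulVr T1U).
have Tsurj e : exists a, T a = e.
  have [a] := hsurj r ((T 1)^-1 * e); rewrite hr => ea; exists a.
  by rewrite -[LHS](mulVKr T1U) -/(t a) ea mulVKr.
(* Surjectivity supplies [a] with u(a) = 0; since [u] does not vanish at nonzero arguments, a =
   0. *)
have u0 : u 0 = 0.
  have [a ea] := Tsurj (- u 0).
  have ua : u a = 0 by rewrite -[LHS](subrK (u 0)) -/(T a) ea addNr.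
  have [a0|a0] := eqVneq a 0; first by rewrite -a0.
  have [Z [Zi Zij _]] := row_ex (or_introl (B := is_true (0 != 0 :> D)) a0).
  have := inverse_map_entry_neq0 Zi Zi (i := i) (j := j); rewrite uE // Zij.
  by move=> /(_ a0 erefl)[_]; rewrite ua eqxx.
split=> [Z Zi Zij|e]; first by rewrite uE // Zij.
have [a ea] := Tsurj e; exists a => [Z Zi Zij|].
  by rewrite uE // Zij -ea /T u0 subr0.
by apply: contra => /eqP a0; rewrite -ea a0 T0.
Qed.

End Additive.

End InverseMap.

(** Zero entries go to zero, so [Phi 1%:M] and its inverse [phi 1%:M] are diagonal;
    [inverse_map_eval] identifies the diagonal entries with those of [phi] at the matrix units. *)
Lemma two_by_two :
  phi 1%:M = phi (delta_mx 0 0) + phi (delta_mx 1 1) /\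
  (forall e : 'M_1, exists a : 'M_1, phi (delta_mx 0 0 *m a *m delta_mx 0 0) =
     (delta_mx 0 0 : 'cV_2) *m e *m (delta_mx 0 0 : 'rV_2)).
Proof.
have [Phi hPhi] := ex_inverse_map.
have n01 : (0 : 'I_2) != 1 by [].
have n10 : (1 : 'I_2) != 0 by [].
have i1 : invertible_mx (1%:M : 'M[D]_2) by apply: invertible_mx1.
have cdelta j : (delta_mx j 0 : 'cV[D]_2) != 0.
  by apply/eqP => /matrixP/(_ j 0)/eqP; rewrite !mxE !eqxx oner_eq0.
have rdelta i : (delta_mx 0 i : 'rV[D]_2) != 0.
  by apply/eqP => /matrixP/(_ 0 i)/eqP; rewrite !mxE !eqxx oner_eq0.
have ev (R : nzRingType) i j (W : 'M[R]_2) :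
    (delta_mx 0 i : 'rV_2) *m W *m (delta_mx j 0 : 'cV_2) = (W i j)%:M.
  by rewrite -rowE -colE [LHS]mx11_scalar !mxE.
have value i Z (d : D) : invertible_mx Z -> Z i i != 0 -> d * Z i i = 1 ->
    exists2 c : E, Phi Z i i * c = 1 &
    phi ((delta_mx i 0 : 'cV_2) *m d%:M *m (delta_mx 0 i : 'rV_2)) =
      (delta_mx i 0 : 'cV_2) *m c%:M *m (delta_mx 0 i : 'rV_2).
  move=> Zi z0 dz; have [c ec] := hfg (cdelta i) (rdelta i) d%:M.
  have := inverse_map_eval hPhi Zi _ _ ec.
  rewrite f_delta g_delta !ev scalar11_eq0 -scalar_mxM dz => /(_ z0 erefl).
  rewrite f_delta g_delta in ec; rewrite [c]mx11_scalar in ec *.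
  by rewrite -scalar_mxM => /scalar11_inj h; exists (c 0 0).
have [zero01 _] := inverse_map_zero_surj hPhi n01 n10.
have [zero10 _] := inverse_map_zero_surj hPhi n10 n01.
have [_ surj00] := inverse_map_zero_surj hPhi n01 n01.
have E1 i j : i != j -> (1%:M : 'M[D]_2) i j = 0.
  by rewrite mxE => /negPf->.
have E11 i : (1%:M : 'M[D]_2) i i = 1 by rewrite mxE eqxx.
split; last first.
  move=> e; have [e0|e0] := eqVneq (e 0 0) 0.
    have -> : e = 0 by rewrite [e]mx11_scalar e0 raddf0.
    by exists 0; rewrite !mulmx0 !mul0mx phi0.
  (* A [Phi] entry e^-1 at [a] becomes, on inversion, the coefficient e of [phi] at a^-1. *)
  have [a ha a0] := surj00 (e 0 0)^-1.
  have {}a0 : a != 0.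
    apply: a0; apply/eqP => h; have /eqP := mulVr (hE e0).
    by rewrite h mul0r eq_sym oner_eq0.
  pose Z := mx2 0 0 a 0 0 1.
  have Zi : invertible_mx Z.
    by apply: (invertible_diag2 n01 n01); rewrite ?oner_neq0.
  have Za : Z 0 0 = a by rewrite (mx2E n01 n01).
  have [||c hc ec] := value 0 Z a^-1 Zi; rewrite ?Za ?mulVr ?hD //.
  exists (a^-1)%:M; rewrite ec [e]mx11_scalar; congr (_ *m _%:M *m _).
  move: hc; rewrite (ha _ Zi Za) => /(congr1 ( *%R (e 0 0))).
  by rewrite mulVKr ?hE // mulr1.
have [X [[ZX _] [P1 P2]]] := hPhi _ i1; rewrite mul1mx in ZX; subst X.
have off i j : i != j -> Phi 1%:M i j = 0.
  have [h1 h2] : Phi 1%:M 0 1 = 0 /\ Phi 1%:M 1 0 = 0.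
    by split; [apply: zero01 | apply: zero10]; rewrite ?E1.
  by move=> ij; case: (I2P i n01) ij => ->; case: (I2P j n01) => ->.
have diag i : exists2 c, phi (delta_mx i i) = c *: delta_mx i i &
    Phi 1%:M i i * c = 1.
  have [||c hc] := value i 1%:M 1 i1; rewrite ?E11 ?oner_neq0 ?mulr1 //.
  rewrite mulmx1 mul_delta_mx => ec; exists c => //; rewrite ec.
  rewrite -mulmxA mul_scalar_mx; apply/matrixP=> k l.
  rewrite !mxE big_ord1 !mxE eqxx andbT !mulrb.
  by case: (k == i); rewrite ?mul1r ?mul0r //= ?mulr0.
have phi1 i j : phi 1%:M i j = if i == j then phi (delta_mx i i) i i else 0.
  have PiU k : Phi 1%:M k k \is a GRing.unit.
    apply: hE; apply/eqP => h; have [c _ /eqP] := diag k.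
    by rewrite h mul0r eq_sym oner_eq0.
  have /matrixP/(_ i j) := P2.
  rewrite [LHS]mxE (bigD1 i) //= big1 ?addr0 => [|k ki].
    rewrite mxE; have [<-|ij] := eqVneq i j => h; last first.
      by apply: (mulrI (PiU i)); rewrite h mulr0.
    have [c -> hc] := diag i; rewrite !mxE !eqxx mulr1.
    by apply: (mulrI (PiU i)); rewrite h hc.
  by rewrite off ?mul0r // eq_sym.
have [c0 e0 _] := diag 0; have [c1 e1 _] := diag 1.
apply/matrixP=> i j; rewrite phi1 e0 e1.
by case: (I2P i n01) => ->; case: (I2P j n01) => ->;
  rewrite ?e0 ?e1 !mxE ?eqxx /= ?mulr1 ?mulr0 ?addr0 ?add0r.
Qed.

End Two.

(** * Reduction to two by two matrices *)

Definition cols2 (R : Type) m (x1 x2 : 'cV[R]_m) : 'M[R]_(m, 2) :=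
  \matrix_(i, j) (if j == 0 then x1 else x2) i 0.

Definition rows2 (R : Type) n (y1 y2 : 'rV[R]_n) : 'M[R]_(2, n) :=
  \matrix_(i, j) (if i == 0 then y1 else y2) 0 j.

Lemma I2_01 : (0 : 'I_2) != 1. Proof. by []. Qed.

Lemma mulmx_2 (R : nzRingType) m n (A : 'M[R]_(m, 2)) (B : 'M[R]_(2, n)) :
  A *m B = col 0 A *m row 0 B + col 1 A *m row 1 B.
Proof.
apply/matrixP=> i j; rewrite mxE (sum_I2 _ I2_01) [RHS]mxE.
by rewrite [X in _ = X + _]mxE [X in _ = _ + X]mxE !big_ord1 !mxE.
Qed.

Lemma col_cols2 (R : Type) m (x1 x2 : 'cV[R]_m) j :
  col j (cols2 x1 x2) = if j == 0 then x1 else x2.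
Proof. by apply/matrixP=> i k; rewrite !mxE (ord1 k). Qed.

Lemma row_rows2 (R : Type) n (y1 y2 : 'rV[R]_n) i :
  row i (rows2 y1 y2) = if i == 0 then y1 else y2.
Proof. by apply/matrixP=> k j; rewrite !mxE (ord1 k). Qed.

Lemma cols2_mul (R : nzRingType) m n (x1 x2 : 'cV[R]_m) (A : 'M[R]_(2, n)) :
  cols2 x1 x2 *m A = x1 *m row 0 A + x2 *m row 1 A.
Proof. by rewrite mulmx_2 !col_cols2. Qed.

Lemma mul_rows2 (R : nzRingType) m n (y1 y2 : 'rV[R]_n) (A : 'M[R]_(m, 2)) :
  A *m rows2 y1 y2 = col 0 A *m y1 + col 1 A *m y2.
Proof. by rewrite mulmx_2 !row_rows2. Qed.

Lemma cols2_delta (R : nzRingType) m (x1 x2 : 'cV[R]_m) j :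
  cols2 x1 x2 *m (delta_mx j 0 : 'cV_2) = if j == 0 then x1 else x2.
Proof. by rewrite -colE col_cols2. Qed.

Lemma delta_rows2 (R : nzRingType) n (y1 y2 : 'rV[R]_n) i :
  (delta_mx 0 i : 'rV_2) *m rows2 y1 y2 = if i == 0 then y1 else y2.
Proof. by rewrite -rowE row_rows2. Qed.

Lemma cols2_linv (D : unitRingType) (hD : division_ring D) p (u b : 'cV[D]_p) :
  u != 0 -> ~ cpar u b -> exists r : 'M_(2, p), r *m cols2 u b = 1%:M.
Proof.
move=> u0 /(cpar_dual hD u0)[r1 [r2 [r1u r1b r2u r2b]]].
exists (rows2 r1 r2); apply/matrixP=> i j.
have -> : (rows2 r1 r2 *m cols2 u b) i j =
    (((delta_mx 0 i : 'rV_2) *m rows2 r1 r2) *m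
     (cols2 u b *m (delta_mx j 0 : 'cV_2))) 0 0.
  by rewrite -mulmxA (mulmxA (rows2 _ _)) -colE -rowE !mxE.
rewrite cols2_delta delta_rows2.
by case: (I2P i I2_01) => ->; case: (I2P j I2_01) => -> /=;
  rewrite ?r1u ?r1b ?r2u ?r2b !mxE.
Qed.

Lemma rows2_rinv (D : unitRingType) (hD : division_ring D) q (v a : 'rV[D]_q) :
  v != 0 -> ~ rpar v a -> exists z : 'M_(q, 2), rows2 v a *m z = 1%:M.
Proof.
move=> v0 /(rpar_dual hD v0)[z1 [z2 [vz1 az1 vz2 az2]]].
exists (cols2 z1 z2); apply/matrixP=> i j.
have -> : (rows2 v a *m cols2 z1 z2) i j =
    (((delta_mx 0 i : 'rV_2) *m rows2 v a) *m
     (cols2 z1 z2 *m (delta_mx j 0 : 'cV_2))) 0 0.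
  by rewrite -mulmxA (mulmxA (rows2 _ _)) -colE -rowE !mxE.
rewrite cols2_delta delta_rows2.
by case: (I2P i I2_01) => ->; case: (I2P j I2_01) => -> /=;
  rewrite ?vz1 ?az1 ?vz2 ?az2 !mxE.
Qed.

Section Plane.
Variables D E : unitRingType.
Hypotheses (hD : division_ring D) (hE : division_ring E).
Hypothesis hcard : (exists d : 'M[D]_1, d != 0 /\ d != 1%:M) \/
  (forall e : 'M[E]_1, e = 0 \/ e = 1%:M).
Hypothesis hsurj : forall (t : {rmorphism D -> E}) (e : E), exists d, t d = e.
Variables m n p q : nat.
Hypotheses (hm : (0 < m)%N) (hn : (0 < n)%N).
Variables (phi : 'M[D]_(m, n) -> 'M[E]_(p, q)).
Hypotheses (hphi : rk1_preserver phi) (phi0 : phi 0 = 0).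
Variables (f : 'cV[D]_m -> 'cV[E]_p) (g : 'rV[D]_n -> 'rV[E]_q).
Hypotheses (al : aligned phi f g) (eal : everywhere_aligned phi).
Variables (x1 x2 : 'cV[D]_m) (y1 y2 : 'rV[D]_n).
Hypotheses (x10 : x1 != 0) (x20 : x2 != 0) (y10 : y1 != 0) (y20 : y2 != 0).
Hypotheses (nf : ~ cpar (f x1) (f x2)) (ng : ~ rpar (g y1) (g y2)).

Let xm := cols2 x1 x2.
Let ym := rows2 y1 y2.
Let fm := cols2 (f x1) (f x2).
Let gm := rows2 (g y1) (g y2).

Let nx : ~ cpar x1 x2.
Proof.
case=> c e; apply: nf; rewrite e.
apply: (aligned_fZ hD hE hn hphi phi0 al) => //.
by apply: contra x20 => /eqP c0; rewrite e c0 mulmx0.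
Qed.

Let ny : ~ rpar y1 y2.
Proof.
case=> c e; apply: ng; rewrite e.
apply: (aligned_gZ hD hE hm hphi phi0 al) => //.
by apply: contra y20 => /eqP c0; rewrite e c0 mul0mx.
Qed.

Let xm_neq0 (k : 'cV[D]_2) : k != 0 -> xm *m k != 0.
Proof.
have [s sx] := cols2_linv hD x10 nx.
apply: contra => /eqP h; by rewrite -[k]mul1mx -sx -mulmxA h mulmx0.
Qed.

Let ym_neq0 (k : 'rV[D]_2) : k != 0 -> k *m ym != 0.
Proof.
have [s sx] := rows2_rinv hD y10 ny.
apply: contra => /eqP h; by rewrite -[k]mulmx1 -sx mulmxA h mul0mx.
Qed.

(** On the matrices xm X ym the values of [phi] have the form fm Y gm, so the compression [phi'] to
    two by two matrices loses nothing ([recon]) and [two_by_two] applies to it. *)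
Lemma plane_additive_surj :
  phi (x1 *m y1 + x2 *m y2) = phi (x1 *m y1) + phi (x2 *m y2) /\
  (forall e : 'M_1, exists a : 'M_1, phi (x1 *m a *m y1) = f x1 *m e *m g y1).
Proof.
have [r rf] := cols2_linv hE (al_f0 al x10) nf.
have [z gz] := rows2_rinv hE (al_g0 al y10) ng.
(* [N] and [N'] test membership in the column span of [fm] and the row span of [gm]. *)
pose N := 1%:M - fm *m r; pose N' := 1%:M - z *m gm.
have Nfm : N *m fm = 0 by rewrite /N mulmxBl mul1mx -mulmxA rf mulmx1 subrr.
have gmN : gm *m N' = 0 by rewrite /N' mulmxBr mulmx1 mulmxA gz mul1mx subrr.
have [N1 N2] : N *m f x1 = 0 /\ N *m f x2 = 0.
  split; [rewrite -[f x1](cols2_delta (f x1) (f x2) 0)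
         | rewrite -[f x2](cols2_delta (f x1) (f x2) 1)];
  by rewrite mulmxA Nfm mul0mx.
have [N'1 N'2] : g y1 *m N' = 0 /\ g y2 *m N' = 0.
  split; [rewrite -[g y1](delta_rows2 (g y1) (g y2) 0)
         | rewrite -[g y2](delta_rows2 (g y1) (g y2) 1)];
  by rewrite -mulmxA gmN mulmx0.
have NP k (A : 'M_(p, k)) : N *m A = 0 -> fm *m (r *m A) = A.
  by rewrite /N mulmxBl mul1mx => /eqP; rewrite subr_eq0 mulmxA => /eqP.
have NP' k (A : 'M_(k, q)) : A *m N' = 0 -> A *m z *m gm = A.
  by rewrite /N' mulmxBr mulmx1 => /eqP; rewrite subr_eq0 mulmxA => /eqP.
pose f' (k : 'cV[D]_2) := r *m f (xm *m k).
pose g' (k : 'rV[D]_2) := g (k *m ym) *m z.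
have ff' (k : 'cV[D]_2) : k != 0 -> fm *m f' k = f (xm *m k).
  move=> k0; apply: NP; have := xm_neq0 k0; rewrite cols2_mul.
  exact: (f_span hD hE hcard hm hn hphi phi0 al x10 x20 y10 y20).
have gg' (k : 'rV[D]_2) : k != 0 -> g' k *m gm = g (k *m ym).
  move=> k0; apply: NP'; have := ym_neq0 k0; rewrite mul_rows2.
  exact: (g_span hD hE hcard hm hn hphi phi0 al x10 x20 y10 y20).
pose phi' X := r *m phi (xm *m X *m ym) *m z.
have phi'0 : phi' 0 = 0 by rewrite /phi' mulmx0 mul0mx phi0 mulmx0 mul0mx.
have gZ := aligned_gZ hD hE hm hphi phi0 al.
(* y1 and y2 are combinations of the rows of X ym; parallel images of these rows would make g(y1)
   and g(y2) parallel by [gpar_span]. *)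
have rows_npar X : invertible_mx X ->
    [/\ row 0 X *m ym != 0, row 1 X *m ym != 0 &
      ~ rpar (g (row 0 X *m ym)) (g (row 1 X *m ym))].
  move=> [W [XW WX]].
  have row0 i : row i X != 0.
    apply/eqP => h; have : delta_mx 0 i = 0 :> 'rV[D]_2.
      by rewrite -[LHS]mulmx1 -XW mulmxA -rowE h mul0mx.
    by move/matrixP/(_ 0 i)/eqP; rewrite !mxE !eqxx oner_eq0.
  split; try exact: ym_neq0; set a0 := row 0 X *m ym; set a1 := row 1 X *m ym.
  have a00 : a0 != 0 by apply: ym_neq0.
  have a10 : a1 != 0 by apply: ym_neq0.
  move=> h; have eW i : (delta_mx 0 i : 'rV_2) *m ym =
      col 0 (row i W) *m a0 + col 1 (row i W) *m a1.
    by rewrite /a0 /a1 -!row_mul -mulmx_2 mulmxA -row_mul WX row1.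
  have := eW 0; have := eW 1; rewrite !delta_rows2 /= => e2 e1.
  have span := gpar_span hD hE hcard hm hphi phi0 al eal a00 a10.
  apply: ng; apply: (@rpar_trans _ _ _ (g a0)).
    apply: (rpar_sym hE (al_g0 al y10)).
    by rewrite e1; apply: span; rewrite -?e1.
  by rewrite e2; apply: span; rewrite -?e2.
have eX X : xm *m X *m ym = x1 *m (row 0 X *m ym) + x2 *m (row 1 X *m ym).
  by rewrite -mulmxA cols2_mul !row_mul.
have rk (c : 'cV[D]_2) (k : 'rV[D]_2) : c != 0 -> k != 0 -> forall a : 'M_1,
    exists b : 'M_1, phi (xm *m (c *m a *m k) *m ym) =
      f (xm *m c) *m b *m g (k *m ym).
  move=> c0 k0 a; have xc0 := xm_neq0 c0; have yk0 := ym_neq0 k0.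
  have [->|a0] := eqVneq a 0.
    by exists 0; rewrite !(mulmx0, mul0mx) phi0.
  have ak0 : a *m (k *m ym) != 0 by apply: mulmx_1r_neq0.
  have [b b0 eb] := aligned_rk1 hD hE hphi phi0 al xc0 ak0.
  have [d ed] := gZ _ _ yk0 a0; exists (b *m d).
  rewrite ed in eb; rewrite (_ : _ *m ym = xm *m c *m (a *m (k *m ym))).
    by rewrite eb !mulmxA.
  by rewrite !mulmxA.
have recon X : fm *m phi' X *m gm = phi (xm *m X *m ym).
  have fin (B : 'M_(p, q)) : N *m B = 0 -> B *m N' = 0 ->
      fm *m (r *m B *m z) *m gm = B.
    by move=> h1 h2; rewrite -mulmxA NP' -?mulmxA ?h2 ?mulmx0 // NP.
  apply: fin; case: (invertible_or_rk1 hD X) => [Xi|[c [k ->]]].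
  - have [a0 a1 na] := rows_npar X Xi; rewrite eX.
    exact: (phi_left_span hD hE hphi phi0 al).
  - have [->|c0] := eqVneq c 0; first by rewrite !(mulmx0, mul0mx) phi0 mulmx0.
    have [->|k0] := eqVneq k 0; first by rewrite !(mulmx0, mul0mx) phi0 mulmx0.
    have [b] := rk c k c0 k0 1%:M; rewrite mulmx1 => ->.
    by rewrite -ff' // !mulmxA Nfm !mul0mx.
  - have [a0 a1 na] := rows_npar X Xi; rewrite eX.
    have gN i : row i X *m ym != 0 -> g (row i X *m ym) *m N' = 0.
      move=> ai; rewrite -gg'; first by rewrite -mulmxA gmN mulmx0.
      by apply: contra ai => /eqP ->; rewrite mul0mx.
    by apply: (phi_right_span hD hE hphi phi0 al) => //; apply: gN.
  - have [->|c0] := eqVneq c 0; first by rewrite !(mulmx0, mul0mx) phi0 mul0mx.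
    have [->|k0] := eqVneq k 0; first by rewrite !(mulmx0, mul0mx) phi0 mul0mx.
    have [b] := rk c k c0 k0 1%:M; rewrite mulmx1 => ->.
    by rewrite -gg' // -!mulmxA gmN !mulmx0.
have inj X Y : X != Y -> xm *m X *m ym != xm *m Y *m ym.
  have [s sx] := cols2_linv hD x10 nx; have [t yt] := rows2_rinv hD y10 ny.
  apply: contra => /eqP /(congr1 (fun A => s *m A *m t)).
  by rewrite !mulmxA sx !mul1mx -!mulmxA yt !mulmx1 => ->.
have pphi' : rk1_preserver phi'.
  move=> X Y XY XY1.
  have [||h1 h2] := hphi (A := xm *m X *m ym) (B := xm *m Y *m ym).
  - exact: inj.
  - by rewrite -mulmxBl -mulmxBr; apply: rk1_mulr; apply: rk1_mull.
  split; first by apply: contra h1 => /eqP e; rewrite -!recon e.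
  by rewrite /phi' -mulmxBl -mulmxBr; apply: rk1_mulr; apply: rk1_mull.
have hfg' (c : 'cV_2) (k : 'rV_2) : c != 0 -> k != 0 -> forall a : 'M_1,
    exists b : 'M_1, phi' (c *m a *m k) = f' c *m b *m g' k.
  move=> c0 k0 a; have [b eb] := rk _ _ c0 k0 a; exists b.
  by rewrite /phi' eb /f' /g' !mulmxA.
have f'd j : f' (delta_mx j 0) = delta_mx j 0.
  rewrite /f' cols2_delta -[RHS]mul1mx -rf -mulmxA cols2_delta.
  by case: ifP.
have g'd i : g' (delta_mx 0 i) = delta_mx 0 i.
  rewrite /g' delta_rows2 -[RHS]mulmx1 -gz mulmxA delta_rows2.
  by case: ifP.
have row_neq0 (c : 'cV[D]_2) j : c j 0 != 0 -> row j c != 0.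
  by apply: contra => /eqP/matrixP/(_ 0 0); rewrite !mxE => ->.
have col_neq0 (k : 'rV[D]_2) j : k 0 j != 0 -> col j k != 0.
  by apply: contra => /eqP/matrixP/(_ 0 0); rewrite !mxE => ->.
have row_eq0 (c : 'cV[E]_2) j : c j 0 = 0 -> row j c = 0.
  by move=> h; apply/matrixP=> k l; rewrite !mxE (ord1 l).
have col_eq0 (k : 'rV[E]_2) j : k 0 j = 0 -> col j k = 0.
  by move=> h; apply/matrixP=> l t; rewrite !mxE (ord1 l).
(* If a coordinate of f'(c) vanished, f(xm c) would be on the line of f(x1) or f(x2). The other of
   x1, x2 is a combination of that one and xm c, so by [fpar_span] f(x1) and f(x2) would be
   parallel. *)
have f'full (c : 'cV_2) : (forall j, c j 0 != 0) -> forall j, f' c j 0 != 0.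
  move=> cf j; have c0 : c != 0.
    by apply: contra (cf 0) => /eqP ->; rewrite mxE.
  have z0 := xm_neq0 c0; have ez := cols2_mul x1 x2 c; have ef := ff' _ c0.
  rewrite cols2_mul in ef; apply/eqP => /row_eq0 fj0.
  have span u v (a b : 'M_1) : u != 0 -> xm *m c = u *m a + v *m b -> b != 0 ->
      v != 0 -> cpar (f u) (f (xm *m c)) -> cpar (f u) (f v).
    move=> u0 e /(mx11_inv hD)[b' [bb' _]] v0 h.
    have ev : v = u *m - (a *m b') + (xm *m c) *m b'.
      by rewrite e mulmxDl mulmxN -!mulmxA bb' mulmx1 addrA addNr add0r.
    rewrite ev; apply: (fpar_span hD hE hcard hn hphi phi0 al eal) => //.
    by rewrite -ev.
  case: (I2P j I2_01) fj0 => -> fj0; rewrite fj0 mulmx0 in ef.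
    apply: nf; apply: (aligned_csym hE al x20 x10).
    apply: (span x2 x1 _ _ x20 _ (row_neq0 _ _ (cf 0)) x10).
      by rewrite ez addrC; reflexivity.
    by rewrite -ef add0r; exists (row 1 (f' c)).
  apply: nf; apply: (span x1 x2 _ _ x10 ez (row_neq0 _ _ (cf 1)) x20).
  by rewrite -ef addr0; exists (row 0 (f' c)).
have g'full (k : 'rV_2) : (forall j, k 0 j != 0) -> forall j, g' k 0 j != 0.
  move=> kf j; have k0 : k != 0.
    by apply: contra (kf 0) => /eqP ->; rewrite mxE.
  have z0 := ym_neq0 k0; have ez := mul_rows2 y1 y2 k; have eg := gg' _ k0.
  rewrite mul_rows2 in eg; apply/eqP => /col_eq0 gj0.
  have span u v (a b : 'M_1) : u != 0 -> k *m ym = a *m u + b *m v -> b != 0 ->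
      v != 0 -> rpar (g u) (g (k *m ym)) -> rpar (g u) (g v).
    move=> u0 e /(mx11_inv hD)[b' [_ b'b]] v0 h.
    have ev : v = - (b' *m a) *m u + b' *m (k *m ym).
      by rewrite e mulmxDr mulNmx !mulmxA b'b mul1mx addrA addNr add0r.
    rewrite ev; apply: (gpar_span hD hE hcard hm hphi phi0 al eal) => //.
    by rewrite -ev.
  case: (I2P j I2_01) gj0 => -> gj0; rewrite gj0 mul0mx in eg.
    apply: ng; apply: (aligned_rsym hE al y20 y10).
    apply: (span y2 y1 _ _ y20 _ (col_neq0 _ _ (kf 0)) y10).
      by rewrite ez addrC; reflexivity.
    by rewrite -eg add0r; exists (col 1 (g' k)).
  apply: ng; apply: (span y1 y2 _ _ y10 ez (col_neq0 _ _ (kf 1)) y20).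
  by rewrite -eg addr0; exists (col 0 (g' k)).
have inv' X : invertible_mx X -> invertible_mx (phi' X).
  move=> Xi; case: (invertible_or_rk1 hE (phi' X)) => // h1.
  have [a0 a1 na] := rows_npar X Xi.
  case: (aligned_rank2 hD hE hcard hm hn hphi phi0 al x10 x20 a0 a1 nf na).
  by rewrite -eX -recon; apply: rk1_mulr; apply: rk1_mull.
have [h1 h2] :=
  two_by_two hD hE hcard hsurj pphi' phi'0 hfg' f'd g'd f'full g'full inv'.
have plane_delta (a : 'M_1) : xm *m (delta_mx 0 0 *m a *m delta_mx 0 0) *m ym =
    x1 *m a *m y1.
  by rewrite !mulmxA cols2_delta -!mulmxA delta_rows2.
split.
  have eI : xm *m 1%:M *m ym = x1 *m y1 + x2 *m y2.
    by rewrite mulmx1 cols2_mul !row_rows2.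
  have ed i : xm *m delta_mx i i *m ym = (if i == 0 then x1 else x2) *m
      (if i == 0 then y1 else y2).
    rewrite -(@mul_delta_mx _ _ 1 _ 0) !mulmxA cols2_delta -mulmxA.
    by rewrite delta_rows2.
  by rewrite -eI -recon h1 mulmxDr mulmxDl !recon !ed.
move=> e; have [a ea] := h2 e; exists a.
rewrite -plane_delta -recon ea !mulmxA cols2_delta -!mulmxA delta_rows2 //.
Qed.

End Plane.

(** * Additivity *)

Lemma everywhere_aligned_recenter (D E : nzRingType) m n p q
    (phi : 'M[D]_(m, n) -> 'M[E]_(p, q)) A :
  everywhere_aligned phi -> everywhere_aligned (recenter phi A).
Proof.
move=> h B; apply: aligned_ext (h (A + B)) => X.
by rewrite /recenter opprB addrA subrK addrA.
Qed.

Section Additivity.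
Variables D E : unitRingType.
Hypotheses (hD : division_ring D) (hE : division_ring E).
Hypothesis hcard : (exists d : 'M[D]_1, d != 0 /\ d != 1%:M) \/
  (forall e : 'M[E]_1, e = 0 \/ e = 1%:M).
Hypothesis hsurj : forall (t : {rmorphism D -> E}) (e : E), exists d, t d = e.
Variables m n p q : nat.
Hypotheses (hm : (0 < m)%N) (hn : (0 < n)%N).
Implicit Types (x : 'cV[D]_m) (y : 'rV[D]_n) (u : 'cV[E]_p) (v : 'rV[E]_q).

Section Injectivity.
Variables (phi : 'M[D]_(m, n) -> 'M[E]_(p, q)).
Hypotheses (hphi : rk1_preserver phi) (phi0 : phi 0 = 0).
Variables (f : 'cV[D]_m -> 'cV[E]_p) (g : 'rV[D]_n -> 'rV[E]_q).
Hypotheses (al : aligned phi f g) (eal : everywhere_aligned phi).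

Lemma preserver_inj_rk1 A B : rk1 (A - B) -> phi A = phi B -> A = B.
Proof.
move=> AB1 e; apply/eqP/negPn/negP => AB.
by have [] := hphi AB AB1; rewrite e eqxx.
Qed.

(** If f(x') = f(x) k, surjectivity on scalars finds [a] with phi (x a y1) = phi (x' y1), and
    injectivity on R(y1) gives x' = x a. *)
Lemma aligned_f_inj x x' : x != 0 -> x' != 0 -> cpar (f x) (f x') -> cpar x x'.
Proof.
move=> x0 x'0 [k ek]; have [y1 y10] := ex_rV_neq0 D hn.
have [x3 x30 nf] := al_f al (al_f0 al x0).
have [y2 y20 ng] := al_g al (al_g0 al y10).
have [_ surj] := plane_additive_surj hD hE hcard hsurj hm hn hphi phi0 al eal
  x0 x30 y10 y20 nf ng.
have [c c0 ec] := aligned_rk1 hD hE hphi phi0 al x'0 y10.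
have [a ea] := surj (k *m c); exists a.
have e : x *m a *m y1 = x' *m y1.
  apply: preserver_inj_rk1; first by rewrite -mulmxBl; exists (x *m a - x'), y1.
  by rewrite ea ec ek !mulmxA.
have [z yz] := row_rinv hD y10.
by rewrite -[LHS]mulmx1 -yz mulmxA -e -mulmxA yz mulmx1.
Qed.

Lemma aligned_g_inj y y' : y != 0 -> y' != 0 -> rpar (g y) (g y') -> rpar y y'.
Proof.
move=> y0 y'0 [k ek]; have [x1 x10] := ex_cV_neq0 D hm.
have [y3 y30 ng] := al_g al (al_g0 al y0).
have [x2 x20 nf] := al_f al (al_f0 al x10).
have [_ surj] := plane_additive_surj hD hE hcard hsurj hm hn hphi phi0 al eal
  x10 x20 y0 y30 nf ng.
have [c c0 ec] := aligned_rk1 hD hE hphi phi0 al x10 y'0.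
have [a ea] := surj (c *m k); exists a.
have e : x1 *m (a *m y) = x1 *m y'.
  apply: preserver_inj_rk1; first by rewrite -mulmxBr; exists x1, (a *m y - y').
  by rewrite mulmxA ea ec ek !mulmxA.
have [r rx] := col_linv hD x10.
by rewrite -[LHS]mul1mx -rx -mulmxA -e mulmxA rx mul1mx.
Qed.

Lemma additive_indep x1 x2 y1 y2 :
  x1 != 0 -> y1 != 0 -> ~ cpar x1 x2 -> ~ rpar y1 y2 ->
  phi (x1 *m y1 + x2 *m y2) = phi (x1 *m y1) + phi (x2 *m y2).
Proof.
move=> x10 y10 nx ny.
have x20 : x2 != 0.
  by apply/eqP => h; apply: nx; exists 0; rewrite h mulmx0.
have y20 : y2 != 0.
  by apply/eqP => h; apply: ny; exists 0; rewrite h mul0mx.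
have [] // := plane_additive_surj hD hE hcard hsurj hm hn hphi phi0 al eal
  x10 x20 y10 y20.
- by move=> /(aligned_f_inj x10 x20).
- by move=> /(aligned_g_inj y10 y20).
Qed.

Lemma ex_cV_indep x : x != 0 -> exists x', ~ cpar x x'.
Proof.
move=> x0; have [x' x'0 nf] := al_f al (al_f0 al x0); exists x' => -[c e].
apply: nf; rewrite e; apply: (aligned_fZ hD hE hn hphi phi0 al) => //.
by apply: contra x'0 => /eqP c0; rewrite e c0 mulmx0.
Qed.

Lemma ex_rV_indep y : y != 0 -> exists y', ~ rpar y y'.
Proof.
move=> y0; have [y' y'0 ng] := al_g al (al_g0 al y0); exists y' => -[c e].
apply: ng; rewrite e; apply: (aligned_gZ hD hE hm hphi phi0 al) => //.
by apply: contra y'0 => /eqP c0; rewrite e c0 mul0mx.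
Qed.

End Injectivity.

Section Additive.
Variables (phi : 'M[D]_(m, n) -> 'M[E]_(p, q)).
Hypotheses (hphi : rk1_preserver phi) (phi0 : phi 0 = 0).
Hypotheses (eal : everywhere_aligned phi).

(** The increment of [phi] along R is the same at A + S as at A. Unlike plain additivity, this
    composes in S ([sqD]), so S can be cut into convenient rank one pieces. *)
Let sq (A R S : 'M[D]_(m, n)) :=
  phi (A + R + S) - phi (A + S) = phi (A + R) - phi A.

Let sqD A R S S' : sq A R S -> sq (A + S) R S' -> sq A R (S + S').
Proof.
rewrite /sq => <-; rewrite [A + R + S]addrAC => <-.
by rewrite !addrA [A + R + S]addrAC.
Qed.

Lemma cpar_addr x x' x'' : cpar x x' -> ~ cpar x x'' -> ~ cpar x (x' + x'').
Proof.
move=> [c ->] h [d e]; apply: h; exists (d - c).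
by rewrite mulmxBr -e addrC addKr.
Qed.

Lemma rpar_addr y y' y'' : rpar y y' -> ~ rpar y y'' -> ~ rpar y (y' + y'').
Proof.
move=> [c ->] h [d e]; apply: h; exists (d - c).
by rewrite mulmxBl -e addrC addKr.
Qed.

Lemma cparN x x' : cpar x (- x') -> cpar x x'.
Proof. by case=> c e; exists (- c); rewrite mulmxN -e opprK. Qed.

Lemma rparN y y' : rpar y (- y') -> rpar y y'.
Proof. by case=> c e; exists (- c); rewrite mulNmx -e opprK. Qed.

Lemma preserver_additive A B : phi (A + B) = phi A + phi B.
Proof.
have [f [g al]] : is_aligned phi.
  by apply: aligned_ext (eal 0) => X; rewrite /recenter add0r phi0 subr0.
suff sqx x y S C : x != 0 -> y != 0 -> sq C (x *m y) S.
  elim/mx_rk1_ind: B => [|B x y IH]; first by rewrite phi0 !addr0.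
  have [->|x0] := eqVneq x 0; first by rewrite mul0mx addr0.
  have [->|y0] := eqVneq y 0; first by rewrite mulmx0 addr0.
  have step C : phi (C + x *m y) = phi C + phi (x *m y).
    have := sqx x y C 0 x0 y0; rewrite /sq !add0r phi0 subr0 [x *m y + C]addrC.
    by move/eqP; rewrite subr_eq => /eqP ->; rewrite addrC.
  by rewrite addrA !step IH addrA.
move=> x0 y0; elim/mx_rk1_ind: S C => [|S x' y' IH] C.
  by rewrite /sq !addr0.
apply: sqD => //; move: (C + S) => {S C IH} C.
have indep x'' y'' C' : ~ cpar x x'' -> ~ rpar y y'' ->
    sq C' (x *m y) (x'' *m y'').
  move=> nx ny; have [f' [g' al']] := eal C'.
  have := additive_indep (recenter_preserver C' hphi) (recenter0 phi C') al'
    (everywhere_aligned_recenter C' eal) x0 y0 nx ny.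
  rewrite /recenter addrA /sq => e.
  apply/eqP; rewrite subr_eq -[X in X == _](subrK (phi C')) e.
  by rewrite -addrA subrK.
have [x1 nx1] := ex_cV_indep hphi phi0 al x0.
have [y1 ny1] := ex_rV_indep hphi phi0 al y0.
have nx1' : ~ cpar x (- x1) by move=> /cparN.
have ny1' : ~ rpar y (- y1) by move=> /rparN.
have half x'' y'' C' : ~ rpar y y'' -> sq C' (x *m y) (x'' *m y'').
  move=> ny; have [px|nx] := classic (cpar x x''); last exact: indep.
  (* A column parallel to [x] is split into two columns that are not. *)
  have -> : x'' *m y'' = (x'' + x1) *m y'' + (- x1) *m y''.
    by rewrite -mulmxDl addrK.
  by apply: sqD; apply: indep => //; apply: cpar_addr.
have [py|ny] := classic (rpar y y'); last exact: half.
have -> : x' *m y' = x' *m (y' + y1) + x' *m (- y1).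
  by rewrite -mulmxDr addrK.
by apply: sqD; apply: half => //; apply: rpar_addr.
Qed.

End Additive.
End Additivity.

(** * Factorization *)

Lemma cV_sum_delta (D : nzRingType) m (x : 'cV[D]_m) :
  x = \sum_j delta_mx j 0 *m (x j 0)%:M.
Proof.
apply/matrixP=> i k; rewrite (ord1 k) summxE (bigD1 i) //= big1 ?addr0.
  by rewrite mxE big_ord1 !mxE !eqxx mul1r mulr1n.
by move=> j ji; rewrite mxE big_ord1 !mxE [i == j]eq_sym (negPf ji) mul0r.
Qed.

Lemma rV_sum_delta (D : nzRingType) n (y : 'rV[D]_n) :
  y = \sum_j (y 0 j)%:M *m delta_mx 0 j.
Proof.
apply/matrixP=> k i; rewrite (ord1 k) summxE (bigD1 i) //= big1 ?addr0.
  by rewrite mxE big_ord1 !mxE !eqxx mulr1 mulr1n.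
by move=> j ji; rewrite mxE big_ord1 !mxE [i == j]eq_sym (negPf ji) andbF mulr0.
Qed.

Lemma additive_sum (V W : zmodType) (U : V -> W) (I : finType) (F : I -> V) :
  (forall a b, U (a + b) = U a + U b) -> U (\sum_i F i) = \sum_i U (F i).
Proof.
move=> UD; apply: (big_morph U) => //.
by apply: (addrI (U 0)); rewrite -UD !addr0.
Qed.

Lemma semilinear_cV (D E : unitRingType) m p (tau : {rmorphism D -> E})
    (U : 'cV[D]_m -> 'cV[E]_p) :
  (forall x x', U (x + x') = U x + U x') ->
  (forall x a, U (x *m a%:M) = U x *m (tau a)%:M) ->
  exists Uh : 'M[E]_(p, m), forall x, U x = Uh *m map_mx tau x.
Proof.
move=> UD UZ; exists (\matrix_(i, j) U (delta_mx j 0) i 0) => x.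
rewrite [in LHS](cV_sum_delta x) additive_sum //.
apply/matrixP=> i k; rewrite (ord1 k) summxE mxE; apply: eq_bigr => j _.
by rewrite UZ mxE big_ord1 !mxE mulr1n.
Qed.

Lemma semilinear_rV (D E : unitRingType) n q (tau : {rmorphism D -> E})
    (V : 'rV[D]_n -> 'rV[E]_q) :
  (forall y y', V (y + y') = V y + V y') ->
  (forall y a, V (a%:M *m y) = (tau a)%:M *m V y) ->
  exists Vh : 'M[E]_(n, q), forall y, V y = map_mx tau y *m Vh.
Proof.
move=> VD VZ; exists (\matrix_(i, j) V (delta_mx 0 i) 0 j) => y.
rewrite [in LHS](rV_sum_delta y) additive_sum //.
apply/matrixP=> k i; rewrite (ord1 k) summxE mxE; apply: eq_bigr => j _.
by rewrite VZ mxE big_ord1 !mxE mulr1n.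
Qed.

Section Factor.
Variables D E : unitRingType.
Hypotheses (hD : division_ring D) (hE : division_ring E).
Hypothesis hcard : (exists d : 'M[D]_1, d != 0 /\ d != 1%:M) \/
  (forall e : 'M[E]_1, e = 0 \/ e = 1%:M).
Hypothesis hsurj : forall (t : {rmorphism D -> E}) (e : E), exists d, t d = e.
Variables m n p q : nat.
Hypotheses (hm : (0 < m)%N) (hn : (0 < n)%N).
Implicit Types (x : 'cV[D]_m) (y : 'rV[D]_n) (u : 'cV[E]_p) (v : 'rV[E]_q).
Variables (phi : 'M[D]_(m, n) -> 'M[E]_(p, q)).
Hypotheses (hphi : rk1_preserver phi) (phi0 : phi 0 = 0).
Variables (f : 'cV[D]_m -> 'cV[E]_p) (g : 'rV[D]_n -> 'rV[E]_q).
Hypotheses (al : aligned phi f g) (eal : everywhere_aligned phi).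

Let phiD := preserver_additive hD hE hcard hsurj hm hn hphi phi0 eal.

Lemma lcancel u v v' : u != 0 -> u *m v = u *m v' -> v = v'.
Proof.
by move=> /(col_linv hE)[r ru] /(congr1 (mulmx r)); rewrite !mulmxA ru !mul1mx.
Qed.

Lemma rcancel u u' v : v != 0 -> u *m v = u' *m v -> u = u'.
Proof.
move=> /(row_rinv hE)[z vz] /(congr1 (mulmx^~ z)).
by rewrite -!mulmxA vz !mulmx1.
Qed.

(** U and V are read off from phi (x y0) and phi (x0 y). Elsewhere phi (x y) = U(x) t V(y), and the
    image of (x + x0) (y + y0) having rank at most one forces t V(y) = V(y). *)
Lemma rank1_factor :
  exists (U : 'cV[D]_m -> 'cV[E]_p) (V : 'rV[D]_n -> 'rV[E]_q),
  [/\ forall x y, phi (x *m y) = U x *m V y,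
      forall x, x != 0 -> U x != 0 & forall y, y != 0 -> V y != 0].
Proof.
have [x0 x00] := ex_cV_neq0 D hm; have [y0 y00] := ex_rV_neq0 D hn.
have [x1 nx1] := ex_cV_indep hD hE hn hphi phi0 al x00.
have [y1 ny1] := ex_rV_indep hD hE hm hphi phi0 al y00.
have [c c0 ec] := aligned_rk1 hD hE hphi phi0 al x00 y00.
have g00 := al_g0 al y00; have f00 : f x0 *m c != 0.
  by apply: mulmx_c1_neq0 => //; apply: al_f0 al _ x00.
have [c' [cc' c'c]] := mx11_inv hE c0.
have [U hU] := functional_choice _ (al_R al y00).
have hV' y : exists v, phi (x0 *m y) = f x0 *m c *m v.
  have [b ->] := al_L al x00 y; exists (c' *m b).
  by rewrite mulmxA -(mulmxA (f x0)) cc' mulmx1.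
have [V hV] := functional_choice _ hV'.
have U0 x : x != 0 -> U x != 0.
  move=> xn; have := preserver0_neq0 hD hphi phi0 xn y00; rewrite hU.
  by apply: contra => /eqP ->; rewrite mul0mx.
have V0 y : y != 0 -> V y != 0.
  move=> yn; have := preserver0_neq0 hD hphi phi0 x00 yn; rewrite hV.
  by apply: contra => /eqP ->; rewrite mulmx0.
have Ux0 : U x0 = f x0 *m c by apply: (rcancel g00); rewrite -hU ec.
have Vy0 : V y0 = g y0 by apply: (lcancel f00); rewrite -hV ec.
have UD x x' : U (x + x') = U x + U x'.
  by apply: (rcancel g00); rewrite mulmxDl -!hU mulmxDl phiD.
have VD y y' : V (y + y') = V y + V y'.
  by apply: (lcancel f00); rewrite mulmxDr -!hV mulmxDr phiD.
have Uf x : x != 0 -> cpar (U x) (f x).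
  by move=> xn; apply: (aligned_cpar hD hE hphi phi0 al xn y00); apply: hU.
have Vg y : y != 0 -> rpar (V y) (g y).
  by move=> yn; apply: (aligned_rpar hD hE hphi phi0 al x00 yn); apply: hV.
have UV1 x y : ~ cpar x0 x -> ~ rpar y0 y -> phi (x *m y) = U x *m V y.
  move=> nx ny.
  have xn : x != 0 by apply/eqP => h; apply: nx; exists 0; rewrite h mulmx0.
  have yn : y != 0 by apply/eqP => h; apply: ny; exists 0; rewrite h mul0mx.
  have [b b0 eb] := aligned_rk1 hD hE hphi phi0 al xn yn.
  have [k ek] := Uf x xn; have [l el] := Vg y yn.
  pose t := k *m b *m l.
  have et : phi (x *m y) = U x *m (t *m V y) by rewrite eb ek el !mulmxA.
  have s0 : V (y + y0) != 0.
    apply: V0; apply/eqP => /eqP; rewrite addr_eq0 => /eqP h; apply: ny.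
    by exists (- 1%:M); rewrite h mulNmx mul1mx.
  have : rk1 (phi ((x + x0) *m (y + y0))) by apply: preserver0_rk1.
  rewrite mulmxDl !mulmxDr !phiD et hU hV [phi (x0 *m y0)]ec.
  rewrite -mulmxDr -mulmxDr -Vy0 -VD.
  move=> /(rk1_add_par hE (U0 _ xn) s0)[h|[d ed]].
    case: nx.
    apply: (aligned_f_inj hD hE hcard hsurj hm hn hphi phi0 al eal) => //.
    have : cpar (f x) (f x0).
      apply: cpar_trans (cpar_sym hE (al_f0 al xn) (Uf x xn)) _.
      apply: cpar_trans h _; exists c'; by rewrite -mulmxA cc' mulmx1.
    by apply: (aligned_csym hE al).
  have ety : t *m V y = V y.
    (* As V(y) and V(y0) are not parallel, both coefficients must vanish: d = 1 and t = d. *)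
    have e1 : (t - d) *m V y = (d - 1%:M) *m V y0.
      rewrite !mulmxBl mul1mx; apply/eqP; rewrite subr_eq addrAC eq_sym subr_eq.
      by rewrite ed VD mulmxDr addrC.
    have [d1|d1] := eqVneq (d - 1%:M) 0.
      have : (t - d) *m V y = 0 by rewrite e1 d1 mul0mx.
      case/(mulmx_cr_eq0 hE) => [/eqP|h]; last first.
        by move: (V0 y yn); rewrite h eqxx.
      rewrite subr_eq0 => /eqP ->; move/eqP: d1; rewrite subr_eq0 => /eqP ->.
      by rewrite mul1mx.
    have [d' [_ d'd]] := mx11_inv hE d1.
    case: ny.
    apply: (aligned_g_inj hD hE hcard hsurj hm hn hphi phi0 al eal) => //.
    apply: (aligned_rsym hE al) => //; rewrite -Vy0.
    apply: rpar_trans (rpar_sym hE (al_g0 al yn) (Vg y yn)) _.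
    by exists (d' *m (t - d)); rewrite -mulmxA e1 mulmxA d'd mul1mx.
  by rewrite ety.
have UV2 x y : ~ rpar y0 y -> phi (x *m y) = U x *m V y.
  move=> ny; have [px|nx] := classic (cpar x0 x); last exact: UV1.
  have e : phi ((x + x1) *m y) = U (x + x1) *m V y.
    by apply: UV1 => //; apply: cpar_addr.
  apply: (addIr (phi (x1 *m y))).
  by rewrite -phiD -mulmxDl e UD mulmxDl [phi (x1 *m y)]UV1.
exists U, V; split=> // x y.
have [py|ny] := classic (rpar y0 y); last exact: UV2.
have e : phi (x *m (y + y1)) = U x *m V (y + y1).
  by apply: UV2 => //; apply: rpar_addr.
apply: (addIr (phi (x *m y1))).
by rewrite -phiD -mulmxDr e VD mulmxDr [phi (x *m y1)]UV2.
Qed.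

Lemma standard_factorization :
  exists (tau : {rmorphism D -> E}) (Uh : 'M[E]_(p, m)) (Vh : 'M[E]_(n, q)),
  [/\ bijective tau, forall k : 'cV_m, Uh *m k = 0 -> k = 0,
      left_independent Vh & forall A, phi A = Uh *m map_mx tau A *m Vh].
Proof.
have [U [V [UV U0 V0]]] := rank1_factor.
have [x0 x00] := ex_cV_neq0 D hm; have [y0 y00] := ex_rV_neq0 D hn.
have UD x x' : U (x + x') = U x + U x'.
  apply: (rcancel (V0 _ y00)); rewrite mulmxDl -!UV mulmxDl phiD //.
have VD y y' : V (y + y') = V y + V y'.
  apply: (lcancel (U0 _ x00)); rewrite mulmxDr -!UV mulmxDr phiD //.
have U_0 : U 0 = 0 by apply: (addrI (U 0)); rewrite -UD !addr0.
(* Since (x a) y = x (a y), one map [t] of scalars governs both U and V. *)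
have ht (a : 'M[D]_1) : exists t : 'M[E]_1, V (a *m y0) = t *m V y0.
  have e : U x0 *m V (a *m y0) = U (x0 *m a) *m V y0 by rewrite -!UV mulmxA.
  by apply: (rpar_eq hE (U0 _ x00) e).
have [t et] := functional_choice _ ht.
have Ut x a : U (x *m a) = U x *m t a.
  by apply: (rcancel (V0 _ y00)); rewrite -mulmxA -et -!UV mulmxA.
have Vt y a : V (a *m y) = t a *m V y.
  by apply: (lcancel (U0 _ x00)); rewrite mulmxA -Ut -!UV mulmxA.
have canV (a b : 'M_1) : a *m V y0 = b *m V y0 -> a = b.
  have [z vz] := row_rinv hE (V0 _ y00).
  by move=> /(congr1 (mulmx^~ z)); rewrite -!mulmxA vz !mulmx1.
pose s d := t d%:M 0 0.
have ts d : t d%:M = (s d)%:M by rewrite [LHS]mx11_scalar.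
have sD a b : s (a + b) = s a + s b.
  apply: scalar11_inj; rewrite [RHS]raddfD /= -!ts; apply: canV.
  by rewrite mulmxDl -!Vt raddfD mulmxDl VD.
have sM a b : s (a * b) = s a * s b.
  apply: scalar11_inj; rewrite /= scalar_mxM -!ts; apply: canV.
  by rewrite -mulmxA -!Vt scalar_mxM mulmxA.
have s1 : s 1 = 1.
  by apply: scalar11_inj; rewrite /= -ts; apply: canV; rewrite -Vt !mul1mx.
have [tau htau] := rmorphism_of sD sM s1.
have [Uh hUh] : exists Uh : 'M[E]_(p, m), forall x, U x = Uh *m map_mx tau x.
  by apply: semilinear_cV => // x a; rewrite Ut ts -htau.
have [Vh hVh] : exists Vh : 'M[E]_(n, q), forall y, V y = map_mx tau y *m Vh.
  by apply: semilinear_rV => // y a; rewrite Vt ts -htau.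
have tau_inj : injective tau.
  move=> a b e; apply/eqP; rewrite -subr_eq0; apply/negPn/negP => /hD ab.
  have : tau (a - b) = 0 by rewrite rmorphB e subrr.
  move=> h; have /eqP := rmorph1 tau.
  by rewrite -(mulrV ab) rmorphM h mul0r eq_sym oner_eq0.
have [taui htaui] := functional_choice _ (hsurj tau).
have map_taui k l (A : 'M[E]_(k, l)) : map_mx tau (map_mx taui A) = A.
  by apply/matrixP=> i j; rewrite !mxE.
exists tau, Uh, Vh; split.
- by exists taui => // a; apply: tau_inj; rewrite htaui.
(* Every vector over E lifts through [tau], which is onto, so U being nonzero off 0 gives
   independence over all of E. *)
- move=> k; rewrite -[k]map_taui -hUh; set k' := map_mx taui k => h.
  have -> : k' = 0 by apply/eqP/negPn/negP => /U0; rewrite h eqxx.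
  by rewrite map_mx0.
- move=> k; rewrite -[k]map_taui -hVh; set k' := map_mx taui k => h.
  have -> : k' = 0 by apply/eqP/negPn/negP => /V0; rewrite h eqxx.
  by rewrite map_mx0.
elim/mx_rk1_ind => [|A x y IH]; first by rewrite phi0 map_mx0 mulmx0 mul0mx.
rewrite phiD IH UV hUh hVh map_mxD map_mxM mulmxDr mulmxDl !mulmxA //.
Qed.

End Factor.

(** * Standard form *)

Lemma pad_mx_pid (D : nzRingType) m n p q
    (le_mp : (m <= p)%N) (le_nq : (n <= q)%N) (A : 'M[D]_(m, n)) :
  pad_mx le_mp le_nq A = (pid_mx m : 'M_(p, m)) *m A *m (pid_mx n : 'M_(n, q)).
Proof.
rewrite /pad_mx; move: (p - m)%N (q - n)%N (subnKC le_mp) (subnKC le_nq).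
move=> k l ep eq; subst p q; rewrite castmx_id pid_mx_col pid_mx_row.
rewrite mul_col_mx mul0mx mul1mx.
by rewrite mul_col_mx mul_mx_row mulmx1 mulmx0 mul0mx /block_mx row_mx0.
Qed.

Lemma tr_pad_mx (D : nzRingType) m n p q
    (le_mp : (m <= p)%N) (le_nq : (n <= q)%N) (A : 'M[D]_(m, n)) :
  (pad_mx le_mp le_nq A)^T = pad_mx le_nq le_mp A^T.
Proof. by rewrite /pad_mx trmx_cast tr_block_mx !trmx0. Qed.

Lemma invertible_trc (D : nzRingType) n (S : 'M[D^c]_n) :
  invertible_mx S -> invertible_mx (S^T : 'M[D]_n).
Proof.
case=> T [ST TS]; exists (T^T : 'M[D]_n).
by rewrite -!trmx_mulc ST TS; split; apply: trmx1.
Qed.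

Lemma right_independent_complete (D : unitRingType) (hD : division_ring D) m p
    (U : 'M[D]_(p, m)) :
  (forall k : 'cV_m, U *m k = 0 -> k = 0) ->
  (m <= p)%N /\ exists2 T : 'M[D]_p, invertible_mx T & U = T *m pid_mx m.
Proof.
move=> hU; have hDc : division_ring D^c := hD.
have : left_independent (U^T : 'M[D^c]_(m, p)).
  move=> u uU; apply: trmx_inj; rewrite trmx0; apply: hU.
  by have := congr1 trmx uU; rewrite trmx_mulc trmxK trmx0.
case/(left_independent_complete hDc) => le [S Si eU]; split=> //.
exists (S^T : 'M[D]_p); first exact: invertible_trc.
apply: trmx_inj; rewrite eU; apply: trmx_inj.
by rewrite trmx_mulc trmxK tr_pid_mx.
Qed.

Section Main.
Variables D E : unitRingType.
Hypotheses (hD : division_ring D) (hE : division_ring E).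
Hypothesis hcard : (exists d : 'M[D]_1, d != 0 /\ d != 1%:M) \/
  (forall e : 'M[E]_1, e = 0 \/ e = 1%:M).
Hypothesis hsurj : forall (t : {rmorphism D -> E}) (e : E), exists d, t d = e.
Variables m n p q : nat.
Hypotheses (hm : (0 < m)%N) (hn : (0 < n)%N).
Variables (phi : 'M[D]_(m, n) -> 'M[E]_(p, q)).
Hypotheses (hphi : rk1_preserver phi).

Lemma aligned_standard A : is_aligned (recenter phi A) ->
  exists (le_mp : (m <= p)%N) (le_nq : (n <= q)%N)
    (tau : {rmorphism D -> E}) (T : 'M[E]_p) (S : 'M[E]_q) (R : 'M[E]_(p, q)),
    [/\ bijective tau, invertible_mx T, invertible_mx S &
        forall A : 'M[D]_(m, n),
          phi A = T *m pad_mx le_mp le_nq (map_mx tau A) *m S + R].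
Proof.
move=> al; have pA := recenter_preserver A hphi; have pA0 := recenter0 phi A.
have eal := aligned_everywhere hD hE hcard hm hn pA pA0 al.
have [f [g alfg]] := al.
have [tau [U [V [tb Ui Vi e]]]] :=
  standard_factorization hD hE hcard hsurj hm hn pA pA0 alfg eal.
have [le_mp [T Ti eU]] := right_independent_complete hE Ui.
have [le_nq [S Si eV]] := left_independent_complete hE Vi.
exists le_mp, le_nq, tau, T, S, (phi A - U *m map_mx tau A *m V); split=> // X.
have -> : T *m pad_mx le_mp le_nq (map_mx tau X) *m S = U *m map_mx tau X *m V.
  by rewrite pad_mx_pid eU eV !mulmxA.
rewrite addrCA -mulmxBl -mulmxBr -map_mxB -e /recenter.
by rewrite [A + _]addrC subrK [RHS]addrC subrK.
Qed.

End Main.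

Lemma two_or_more_scalars (D : nzRingType) :
  (exists d : 'M[D]_1, d != 0 /\ d != 1%:M) \/
  (forall e : 'M[D]_1, e = 0 \/ e = 1%:M).
Proof.
have [|h] := classic (exists d : 'M[D]_1, d != 0 /\ d != 1%:M); first by left.
right=> e; have [->|e0] := eqVneq e 0; [by left | right].
by apply/eqP/negPn/negP => e1; apply: h; exists e.
Qed.

(** Applied twice, [t] restores the order of products, so its square is an endomorphism of D; as the
    square is onto, so is [t]. *)
Lemma EAS_converse (D : unitRingType) : EAS D ->
  forall (t : {rmorphism D -> D^c}) (e : D^c), exists d, t d = e.
Proof.
move=> hEAS t e; pose s (d : D) : D := t (t d : D).
have sD a b : s (a + b) = s a + s b by rewrite /s !rmorphD.
have sM a b : s (a * b) = s a * s b by rewrite /s !rmorphM.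
have s1 : s 1 = 1 by rewrite /s !rmorph1.
have [r hr] := rmorphism_of sD sM s1.
by have [d ed] := hEAS r e; exists (t d : D); rewrite -ed hr.
Qed.

Lemma adjacency_rk1_preserver (D : unitRingType) (hD : division_ring D) m n p q
    (phi : 'M[D]_(m, n) -> 'M[D]_(p, q)) :
  adjacency_preserver phi -> rk1_preserver phi.
Proof.
move=> h A B AB AB1; have [] := (has_rank1P hD (phi A - phi B)).1.
  by apply: h; apply/(has_rank1P hD); rewrite subr_eq0.
by rewrite subr_eq0.
Qed.

Theorem theorem1p2 (m n p q : nat) (hm : (0 < m)%N) (hn : (0 < n)%N)
    (hp : (0 < p)%N) (hq : (0 < q)%N)
    (D : unitRingType) (hD : division_ring D) (hEAS : EAS D)
    (phi : 'M[D]_(m, n) -> 'M[D]_(p, q)) (hphi : adjacency_preserver phi) :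
  degenerate phi \/ standard phi.
Proof.
have [|/not_all_ex_not[A nA]] := classic (degenerate phi); [by left | right].
have pphi := adjacency_rk1_preserver hD hphi.
have ndeg : ~ degenerate_rk1 (recenter phi A).
  case=> x [y [x0 y0 h]]; apply: nA; exists x, y; split=> // B.
  case/(rk1_rank_le1 hD) => u [v ->].
  by case: (h u v) => -[b eb]; [right | left]; exists b.
have pA := recenter_preserver A pphi.
case: (clique_types hD hD hm hn pA (recenter0 phi A)) => [//|al|[hR hL]].
  left.
  exact: (aligned_standard hD hD (two_or_more_scalars D) hEAS hm hn pphi al).
right; have hDc : division_ring D^c := hD.
(* Only the target is transposed here, unlike in [transposed]: L cliques, which went to R cliques,
   now go to L cliques. *)
pose psi X : 'M[D^c]_(q, p) := (phi X)^T.
have ppsi : rk1_preserver psi.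
  move=> X Y XY XY1; have [h1 h2] := pphi X Y XY XY1; split.
    by apply: contra h1 => /eqP/trmx_inj ->.
  by have := rk1_trc h2; rewrite linearB.
have epsi X : recenter psi A X = (recenter phi A X)^T.
  by rewrite /recenter /psi linearB.
have al : is_aligned (recenter psi A).
  apply: (aligned_of_types hm hn).
  - exact: recenter0.
  - move=> x /hR[v v0 hv]; exists v^T; first by rewrite trmx_neq0.
    by move=> a; have [b eb] := hv a; exists b^T; rewrite epsi eb mulmx_trc.
  - move=> y /hL[u u0 hu]; exists u^T; first by rewrite trmx_neq0.
    by move=> a; have [b eb] := hu a; exists b^T; rewrite epsi eb mulmx_trc.
  case=> u [v [u0 v0 h]]; apply: ndeg.
  exists (v^T : 'cV[D]_p), (u^T : 'rV[D]_q).
  split; rewrite ?trmx_neq0 // => x y.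
  case: (h x y) => -[b]; rewrite epsi => eb.
    right; exists (b^T : 'cV[D]_p); rewrite -trmx_mulc.
    by apply: trmx_inj; rewrite eb trmxK.
  left; exists (b^T : 'rV[D]_q); rewrite -trmx_mulc.
  by apply: trmx_inj; rewrite eb trmxK.
have [le_mq [le_np [tau [T [S [R [tb Ti Si e]]]]]]] :=
  aligned_standard hD hDc (two_or_more_scalars D) (EAS_converse hEAS) hm hn
    ppsi al.
(* Transposing back exchanges the left and right invertible factors. *)
exists le_np, le_mq, tau, (S^T : 'M[D]_p), (T^T : 'M[D]_q).
exists (R^T : 'M[D]_(p, q)).
split=> //; [exact: invertible_trc | exact: invertible_trc |] => X.
apply: trmx_inj; rewrite [LHS](e X) linearD /= trmxK; congr (_ + _).
rewrite -tr_pad_mx; apply: trmx_inj; rewrite trmxK.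
rewrite trmx_mulc trmx_mulc mulmxA; reflexivity.
Qed.
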